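(* Let $H$ be a graph and let $0<\delta\leqslant 1/2$. Suppose there is a polynomial-time algorithm which takes as input any $H$-free graph $G$ and outputs a set of at least $|V(G)|^{\delta}$ vertices of $G$ that is either a clique or an independent set. Then for every fixed $\varepsilon>0$, $H$ satisfies the improved approximation property with constant $\delta-\delta^2-\varepsilon$; that is, there is a polynomial-time algorithm which, given an $H$-free graph $G$ on $n$ vertices, outputs an independent set of $G$ of size at least $\alpha(G)/n^{1-(\delta-\delta^2-\varepsilon)}$.
   Context: All graphs are finite and simple. A graph $G$ is $H$-free if it has no induced subgraph isomorphic to $H$. $\alpha(G)$ denotes the maximum size of an independent set of $G$. Maximum Independent Set (MIS) is the problem of finding a maximum-size independent set. A (randomized) $\rho$-approximation algorithm for MIS outputs (with probability tending to $1$ as the number $n$ of vertices tends to infinity, in the randomized case) an independent set of size at least $\alpha(G)/\rho$. A graph $H$ satisfies the improved approximation property with constant $\varepsilon'>0$ if MIS admits a (randomized) polynomial-time $n^{1-\varepsilon'}$-approximation algorithm on every $H$-free $n$-vertex graph. *)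

(* Defs.v *)
From Stdlib Require Import Reals Arith List Bool.
Import ListNotations.
Open Scope R_scope.

(* ---------- Finite simple graphs on vertex set {0,...,gn-1} ---------- *)
Record graph := Graph {
  gn : nat;
  gadj : nat -> nat -> bool;
  gadj_sym : forall i j, gadj i j = gadj j i;
  gadj_irrefl : forall i, gadj i i = false }.

Definition induced_copy (H G : graph) : Prop :=
  exists f : nat -> nat,
    (forall i, (i < gn H)%nat -> (f i < gn G)%nat) /\
    (forall i j, (i < gn H)%nat -> (j < gn H)%nat -> f i = f j -> i = j) /\
    (forall i j, (i < gn H)%nat -> (j < gn H)%nat ->
        gadj H i j = gadj G (f i) (f j)).

Definition H_free (H G : graph) : Prop := ~ induced_copy H G.

Definition vset (G : graph) (S : list nat) : Prop :=
  NoDup S /\ forall v, In v S -> (v < gn G)%nat.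

Definition independent (G : graph) (S : list nat) : Prop :=
  vset G S /\ forall u v, In u S -> In v S -> gadj G u v = false.

Definition clique (G : graph) (S : list nat) : Prop :=
  vset G S /\ forall u v, In u S -> In v S -> u <> v -> gadj G u v = true.

Fixpoint sublists (l : list nat) : list (list nat) :=
  match l with
  | [] => [[]]
  | x :: r => let s := sublists r in map (cons x) s ++ s
  end.

Definition indepb (G : graph) (S : list nat) : bool :=
  forallb (fun u => forallb (fun v => negb (gadj G u v)) S) S.

Definition alpha (G : graph) : nat :=
  fold_right Nat.max 0%nat
    (map (@length nat) (filter (indepb G) (sublists (seq 0 (gn G))))).

Definition npow (n : nat) (x : R) : R :=
  match n with O => 0 | _ => Rpower (INR n) x end.

Definition enc (G : graph) : list bool :=
  flat_map (fun i => map (fun j => gadj G i j) (seq 0 (gn G))) (seq 0 (gn G)).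

Definition decode_set (n : nat) (s : list bool) : list nat :=
  filter (fun i => nth i s false) (seq 0 n).

Inductive sym := Blank | Zero | One.
Inductive move := MoveL | MoveR | Stay.

Record TM := {
  tm_states : nat;                       (* states are 0 .. tm_states-1 *)
  tm_start : nat;
  tm_halt : nat;
  tm_delta : nat -> sym -> nat * sym * move }.

(* finiteness: the machine only ever uses its finitely many states *)
Definition tm_valid (M : TM) : Prop :=
  (tm_start M < tm_states M)%nat /\ (tm_halt M < tm_states M)%nat /\
  forall q s, (q < tm_states M)%nat -> (fst (fst (tm_delta M q s)) < tm_states M)%nat.

Record config := Config {
  c_state : nat; c_left : list sym; c_head : sym; c_right : list sym }.

Definition step (M : TM) (c : config) : config :=
  if Nat.eqb (c_state c) (tm_halt M) then c else
  match tm_delta M (c_state c) (c_head c) with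
  | (q', s', MoveL) =>
      match c_left c with
      | [] => Config q' [] Blank (s' :: c_right c)
      | a :: l => Config q' l a (s' :: c_right c)
      end
  | (q', s', MoveR) =>
      match c_right c with
      | [] => Config q' (s' :: c_left c) Blank []
      | a :: r => Config q' (s' :: c_left c) a r
      end
  | (q', s', Stay) => Config q' (c_left c) s' (c_right c)
  end.

Fixpoint run (M : TM) (k : nat) (c : config) : config :=
  match k with O => c | S k' => run M k' (step M c) end.

Definition sym_of_bool (b : bool) : sym := if b then One else Zero.

Definition init (M : TM) (x : list bool) : config :=
  match map sym_of_bool x with
  | [] => Config (tm_start M) [] Blank []
  | a :: r => Config (tm_start M) [] a r
  end.

Fixpoint read_word (l : list sym) : list bool :=
  match l with
  | Zero :: r => false :: read_word r
  | One :: r => true :: read_word r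
  | _ => []
  end.

Definition output (c : config) : list bool := read_word (c_head c :: c_right c).

Definition runs_within (M : TM) (x : list bool) (t : nat) (y : list bool) : Prop :=
  exists k, (k <= t)%nat /\ c_state (run M k (init M x)) = tm_halt M /\
            output (run M k (init M x)) = y.

Definition polytime_graph_algorithm (P : graph -> Prop)
    (Q : graph -> list nat -> Prop) : Prop :=
  exists (M : TM) (c : nat), tm_valid M /\
    forall G, P G ->
      exists y, runs_within M (enc G) (c * (length (enc G) + 2) ^ c) y /\
                length y = gn G /\ Q G (decode_set (gn G) y).

(* Main.v *)
(* Repeatedly apply the given algorithm to the subgraph induced by the remaining vertex set R, starting with all vertices. If it returns an independent set, output this set; otherwise it returns a clique with at least two vertices, which is deleted from R (when nothing remains, R is reset to a single vertex). A clique contains at most one vertex of an independent set. Let k = |R|, b = 1 - delta + delta^2 and let s be the size of the final output. By induction on k, an independent set contained in R has at most s (k+1)/2 and at most s k^b vertices. The first bound only uses that every deleted clique has at least two vertices. It implies the second one as long as k^delta <= 2, by concavity of the power; beyond, a clique has c >= max(3, k^delta) vertices, and (k - c)^b + 1 <= k^b. Thus the bound holds for every n, with no loss for small graphs.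

The algorithm is implemented on a Turing machine by way of a structured tape language, in which twelve stacks of bits share the tape; the given machine is simulated with two of these stacks. *)
Require Import Defs.
From Stdlib Require Import Reals Arith List Bool ZArith Lia Lra.
Import ListNotations.
Open Scope nat_scope.

(** * Compiling structured tape programs *)

(** Where the exponent comes from: with [b = 1 - delta + delta^2], deleting [c >= k^delta] vertices
    lowers [k^b] by at least [b * c * k^(b-1) >= b * k^(delta^2)], and this has to reach 1. It does
    once [k^delta >= e], because [b * e^delta >= b * (1 + delta) = 1 + delta^3]. For smaller [k] the
    size [c] itself must be at least [e]. A clique of size 3 will do, but one of size 2 will not:
    near [k^delta = 2] the gain is about [b * 2^delta], which is below 1 for small [delta]. This is
    why a linear bound is carried along for small [k]. On the machine side, the model has a single
    tape with three symbols, while an arbitrary given machine must be rerun on changing inputs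
    without damaging the other data. Keeping its tape in stacks, symbol by symbol, confines it at a
    polynomial cost. *)

Definition pick {A : Type} (s : sym) (a b c : A) : A :=
  match s with Blank => a | Zero => b | One => c end.

Inductive tcom :=
| TSkip
| TMv (d : move)
| TWr (s : sym)
| TSeq (p q : tcom)
| TCase (pb p0 p1 : tcom)
| TLoop (g e p0 p1 : tcom).

Notation "p ;; q" := (TSeq p q) (at level 61, right associativity).

Definition tape := Z -> sym.

Definition tput (t : tape) (x : Z) (s : sym) : tape :=
  fun z => if Z.eqb z x then s else t z.

Definition dz (d : move) : Z :=
  match d with MoveL => (-1)%Z | MoveR => 1%Z | Stay => 0%Z end.

(* In [texec p t x n t' x'], the number [n] is an upper bound on the machine steps. [TLoop g e p0 p1] repeats [g] followed by [p0] or [p1] until [g] ends on a blank cell, and then does [e]. *)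
Inductive texec : tcom -> tape -> Z -> nat -> tape -> Z -> Prop :=
| ESkip t x n : texec TSkip t x n t x
| EMv d t x n : 1 <= n -> texec (TMv d) t x n t (x + dz d)
| EWr s t x n : 1 <= n -> texec (TWr s) t x n (tput t x s) x
| ESeq p q t x m t1 x1 m' t2 x2 n :
    texec p t x m t1 x1 -> texec q t1 x1 m' t2 x2 -> m + m' <= n ->
    texec (p ;; q) t x n t2 x2
| ECase pb p0 p1 t x m t1 x1 n :
    texec (pick (t x) pb p0 p1) t x m t1 x1 -> m + 2 <= n ->
    texec (TCase pb p0 p1) t x n t1 x1
| EExit g e p0 p1 t x m t1 x1 m' t2 x2 n :
    texec g t x m t1 x1 -> t1 x1 = Blank -> texec e t1 x1 m' t2 x2 ->
    m + m' + 2 <= n -> texec (TLoop g e p0 p1) t x n t2 x2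
| ELoop g e p0 p1 t x m t1 x1 m' t2 x2 m'' t3 x3 n :
    texec g t x m t1 x1 -> t1 x1 <> Blank ->
    texec (pick (t1 x1) e p0 p1) t1 x1 m' t2 x2 ->
    texec (TLoop g e p0 p1) t2 x2 m'' t3 x3 ->
    m + m' + 2 + m'' <= n -> texec (TLoop g e p0 p1) t x n t3 x3.

Lemma texec_le p t x n t' x' m :
  texec p t x n t' x' -> n <= m -> texec p t x m t' x'.
Proof.
  intros E L; inversion E; subst; econstructor; eauto; lia.
Qed.

(** A block of consecutive states: placed at [b], its entry [i] is the transition row of state
    [b + i]. *)
Definition code := list (sym -> nat * sym * move).

Definition jump (q : nat) : sym -> nat * sym * move := fun s => (q, s, Stay).

Definition branch (qb q0 q1 : nat) : sym -> nat * sym * move :=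
  fun s => (pick s qb q0 q1, s, Stay).

Fixpoint tsize (p : tcom) : nat :=
  match p with
  | TSkip => 0
  | TMv _ | TWr _ => 1
  | p ;; q => tsize p + tsize q
  | TCase pb p0 p1 => 1 + tsize pb + 1 + tsize p0 + 1 + tsize p1
  | TLoop g e p0 p1 => tsize g + 1 + tsize e + 1 + tsize p0 + 1 + tsize p1 + 1
  end.

(** A block is entered at its first state [b] and left at [b + tsize p], the state just after its
    last one. Sequencing is therefore concatenation, and [TSkip] occupies no state. *)
Fixpoint compile (p : tcom) (b : nat) : code :=
  match p with
  | TSkip => []
  | TMv d => [fun s => (b + 1, s, d)]
  | TWr s' => [fun _ => (b + 1, s', Stay)]
  | p ;; q => compile p b ++ compile q (b + tsize p)
  | TCase pb p0 p1 =>
      let b0 := b + 1 + tsize pb + 1 in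
      let b1 := b0 + tsize p0 + 1 in
      let last := b1 + tsize p1 in
      [branch (b + 1) b0 b1] ++ compile pb (b + 1) ++ [jump last] ++
      compile p0 b0 ++ [jump last] ++ compile p1 b1
  | TLoop g e p0 p1 =>
      let be := b + tsize g + 1 in
      let b0 := be + tsize e + 1 in
      let b1 := b0 + tsize p0 + 1 in
      let last := b1 + tsize p1 + 1 in
      compile g b ++ [branch be b0 b1] ++ compile e be ++ [jump last] ++
      compile p0 b0 ++ [jump b] ++ compile p1 b1 ++ [jump b]
  end.

Lemma compile_length p b : length (compile p b) = tsize p.
Proof.
  revert b; induction p; intros b; simpl; auto;
    rewrite ?length_app; simpl; rewrite ?length_app; simpl;
    rewrite ?length_app; simpl; rewrite ?length_app; simpl; auto; try congruence;
    rewrite ?IHp1, ?IHp2, ?IHp3, ?IHp4; lia.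
Qed.

Definition targets_le (B : nat) (c : code) : Prop :=
  Forall (fun e => forall s, fst (fst (e s)) <= B) c.

Lemma targets_le_mono B B' c : targets_le B c -> B <= B' -> targets_le B' c.
Proof.
  intros F L; eapply Forall_impl; [|exact F].
  simpl; intros e He s; specialize (He s); lia.
Qed.

Lemma compile_targets p b : targets_le (b + tsize p) (compile p b).
Proof.
  revert b; induction p; intros b; simpl; unfold targets_le;
    repeat match goal with
    | |- Forall _ (_ ++ _) => apply Forall_app; split
    | |- Forall _ (_ :: _) => constructor
    | |- Forall _ [] => constructor
    end;
    try (intros []; simpl; lia);
    (eapply targets_le_mono; [match goal with H : _ |- _ => apply H end|lia]).
Qed.

(** The inequality keeps the machine running inside the block, since [step] freezes at the halting
    state. *)
Definition code_at (M : TM) (b : nat) (c : code) : Prop :=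
  forall i f, nth_error c i = Some f ->
    (forall s, tm_delta M (b + i) s = f s) /\ b + i <> tm_halt M.

Lemma code_at_app M b c1 c2 :
  code_at M b (c1 ++ c2) -> code_at M b c1 /\ code_at M (b + length c1) c2.
Proof.
  intros H; split; intros i f E.
  - apply H. rewrite nth_error_app1; auto.
    apply nth_error_Some; congruence.
  - rewrite <- Nat.add_assoc; apply H.
    rewrite nth_error_app2 by lia. now replace (length c1 + i - length c1) with i by lia.
Qed.

Lemma code_at_one M b f :
  code_at M b [f] -> (forall s, tm_delta M b s = f s) /\ b <> tm_halt M.
Proof.
  intros H; destruct (H 0 f eq_refl) as [H1 H2].
  rewrite Nat.add_0_r in *; auto.
Qed.

(** The lists of a configuration end somewhere; the default of [nth] extends them by blanks to a
    two-way infinite tape, so that configurations differing only in trailing blanks show the same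
    tape. *)
Definition shows (c : config) (t : tape) (x : Z) : Prop :=
  c_head c = t x /\
  (forall i, nth i (c_right c) Blank = t (x + 1 + Z.of_nat i)%Z) /\
  (forall i, nth i (c_left c) Blank = t (x - 1 - Z.of_nat i)%Z).

Lemma shows_ext c t t' x : (forall z, t z = t' z) -> shows c t x -> shows c t' x.
Proof.
  intros E (H1 & H2 & H3); split; [|split]; intros; rewrite <- E; auto.
Qed.

Lemma tput_same t x z : tput t x (t x) z = t z.
Proof.
  unfold tput; destruct (Z.eqb_spec z x); subst; auto.
Qed.

Lemma step_shows M c t x q' s' d :
  shows c t x -> c_state c <> tm_halt M ->
  tm_delta M (c_state c) (t x) = (q', s', d) ->
  shows (step M c) (tput t x s') (x + dz d) /\ c_state (step M c) = q'.
Proof.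
  intros (H1 & H2 & H3) Hq Hd. unfold step.
  rewrite (proj2 (Nat.eqb_neq _ _) Hq), H1, Hd.
  assert (P : forall z, z <> x -> tput t x s' z = t z)
    by (intros z Hz; unfold tput; now rewrite (proj2 (Z.eqb_neq _ _) Hz)).
  assert (P0 : tput t x s' x = s') by (unfold tput; now rewrite Z.eqb_refl).
  assert (NN : forall (l : list sym) i, nth (S i) l Blank = nth i (tl l) Blank)
    by (intros [|a l] [|i]; reflexivity).
  (* [hd Blank] and [tl] treat the empty and the nonempty list alike: moving past the end supplies a
     blank. *)
  assert (L : shows (Config q' (tl (c_left c)) (hd Blank (c_left c)) (s' :: c_right c))
                (tput t x s') (x + -1)).
  { split; [|split]; simpl.
    - rewrite P by lia. specialize (H3 0). destruct (c_left c); simpl in *; rewrite H3; f_equal; lia.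
    - intros [|i]; simpl.
      + replace (x + -1 + 1 + 0)%Z with x by lia; auto.
      + rewrite P, H2 by lia; f_equal; lia.
    - intros i. rewrite P, <- NN, H3 by lia; f_equal; lia. }
  assert (R : shows (Config q' (s' :: c_left c) (hd Blank (c_right c)) (tl (c_right c)))
                (tput t x s') (x + 1)).
  { split; [|split]; simpl.
    - rewrite P by lia. specialize (H2 0). destruct (c_right c); simpl in *; rewrite H2; f_equal; lia.
    - intros i. rewrite P, <- NN, H2 by lia; f_equal; lia.
    - intros [|i]; simpl.
      + replace (x + 1 - 1 - 0)%Z with x by lia; auto.
      + rewrite P, H3 by lia; f_equal; lia. }
  destruct d; simpl.
  - destruct (c_left c); simpl in *; auto.
  - destruct (c_right c); simpl in *; auto.
  - split; auto. rewrite Z.add_0_r. split; [|split]; simpl; auto;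
      intros i; rewrite P by lia; auto.
Qed.

Definition reaches (M : TM) (c : config) (n : nat) (q : nat) (t : tape) (x : Z) : Prop :=
  exists m, m <= n /\ c_state (run M m c) = q /\ shows (run M m c) t x.

Lemma run_add M m n c : run M (m + n) c = run M n (run M m c).
Proof. revert c; induction m; simpl; auto. Qed.

Lemma reaches_step M c t x q' s' d n q t2 x2 :
  shows c t x -> c_state c <> tm_halt M ->
  tm_delta M (c_state c) (t x) = (q', s', d) ->
  (forall c', shows c' (tput t x s') (x + dz d) -> c_state c' = q' -> reaches M c' n q t2 x2) ->
  reaches M c (S n) q t2 x2.
Proof.
  intros H1 H2 H3 K.
  destruct (step_shows _ _ _ _ _ _ _ H1 H2 H3) as [S1 S2].
  destruct (K _ S1 S2) as (m & Hm & R).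
  exists (S m); split; [lia|exact R].
Qed.

Lemma reaches_seq M c m q1 t1 x1 n q t2 x2 :
  reaches M c m q1 t1 x1 ->
  (forall c', shows c' t1 x1 -> c_state c' = q1 -> reaches M c' n q t2 x2) ->
  reaches M c (m + n) q t2 x2.
Proof.
  intros (a & Ha & E & S1) K.
  destruct (K _ S1 E) as (b & Hb & R).
  exists (a + b); split; [lia|]. now rewrite run_add.
Qed.

Lemma reaches_le M c m n q t x : reaches M c m q t x -> m <= n -> reaches M c n q t x.
Proof. intros (a & Ha & R) L; exists a; split; [lia|exact R]. Qed.

Lemma reaches_jump M c t x f n q t2 x2 q' :
  code_at M (c_state c) [f] -> f (t x) = (q', t x, Stay) -> shows c t x ->
  (forall c', shows c' t x -> c_state c' = q' -> reaches M c' n q t2 x2) ->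
  reaches M c (S n) q t2 x2.
Proof.
  intros C F S1 K. apply code_at_one in C as [C1 C2].
  eapply reaches_step; eauto.
  - rewrite C1; exact F.
  - simpl; rewrite Z.add_0_r; intros c' S2 E.
    apply K; auto. eapply shows_ext; [|exact S2]; intros; apply tput_same.
Qed.

(** The induction is on the execution rather than on the program, because each iteration of a loop
    runs the same code again. *)
Theorem compile_correct p t x n t' x' :
  texec p t x n t' x' -> forall M b c,
  code_at M b (compile p b) -> c_state c = b -> shows c t x ->
  reaches M c n (b + tsize p) t' x'.
Proof.
  induction 1; intros M b c C Hq Hs; cbn [compile tsize] in C |- *.
  - exists 0; rewrite Nat.add_0_r; repeat split; auto; try lia; apply Hs.
  - apply code_at_one in C as [C1 C2].
    eapply reaches_le; [eapply reaches_step with (n := 0); eauto|lia].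
    + congruence.
    + rewrite Hq, C1; reflexivity.
    + intros c' S' E. exists 0; repeat split; auto; simpl; try lia.
      all: eapply shows_ext in S'; [apply S'|]; intros; apply tput_same.
  - apply code_at_one in C as [C1 C2].
    eapply reaches_le; [eapply reaches_step with (n := 0); eauto|lia].
    + congruence.
    + rewrite Hq, C1; reflexivity.
    + simpl; rewrite Z.add_0_r. intros c' S' E. exists 0; repeat split; auto; simpl; try lia; apply S'.
  - apply code_at_app in C as [C1 C2]. rewrite compile_length in C2.
    eapply reaches_le; [|exact H1].
    eapply reaches_seq; [eapply IHtexec1; eauto|].
    intros; rewrite Nat.add_assoc; eapply IHtexec2; eauto.
  - set (b0 := b + 1 + tsize pb + 1) in *. set (b1 := b0 + tsize p0 + 1) in *.
    repeat (apply code_at_app in C as [? C]; rewrite ?compile_length in C; simpl length in C).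
    replace (b + 1 + tsize pb + 1) with b0 in * by lia.
    replace (b0 + tsize p0 + 1) with b1 in * by lia.
    replace (b + (1 + tsize pb + 1 + tsize p0 + 1 + tsize p1)) with (b1 + tsize p1)
      by (unfold b1, b0; lia).
    eapply reaches_le with (m := S (m + 1)); [|lia].
    subst b. destruct (t x) eqn:Ex; simpl in H.
    all: eapply reaches_jump; [eassumption|rewrite Ex; reflexivity|eassumption|].
    all: intros c' S' E'; cbn [pick branch] in E', IHtexec.
    all: try (eapply reaches_seq; [eapply IHtexec; [eassumption|exact E'|exact S']|];
              intros c'' S'' E''; eapply reaches_jump;
              [rewrite E''; eassumption|reflexivity|eassumption|];
              intros c3 S3 E3; exists 0; repeat split; auto; apply S3).
    eapply reaches_le; [eapply IHtexec; eauto|lia].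
  - set (be := b + tsize g + 1) in *. set (b0 := be + tsize e + 1) in *.
    set (b1 := b0 + tsize p0 + 1) in *.
    repeat (apply code_at_app in C as [? C]; rewrite ?compile_length in C; simpl length in C).
    replace (b + tsize g + 1) with be in * by lia.
    replace (be + tsize e + 1) with b0 in * by lia.
    replace (b + (tsize g + 1 + tsize e + 1 + tsize p0 + 1 + tsize p1 + 1))
      with (b1 + tsize p1 + 1) by (unfold b1, b0, be; lia).
    eapply reaches_le with (m := m + S (m' + 1)); [|lia].
    eapply reaches_seq; [eapply IHtexec1; eauto|].
    intros c1 S1 E1. eapply reaches_jump;
      [rewrite E1; eassumption|reflexivity|eassumption|].
    rewrite H0; cbn [pick]. intros c2 S2 E2.
    eapply reaches_seq; [eapply IHtexec2; eauto|].
    intros c3 S3 E3. eapply reaches_jump;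
      [rewrite E3; eassumption|reflexivity|eassumption|].
    intros c4 S4 E4; exists 0; repeat split; auto; apply S4.
  (* [Call] keeps the code of the whole loop, which the jump back to [b] enters again. *)
  - pose proof C as Call. set (be := b + tsize g + 1) in *. set (b0 := be + tsize e + 1) in *.
    set (b1 := b0 + tsize p0 + 1) in *.
    repeat (apply code_at_app in C as [? C]; rewrite ?compile_length in C; simpl length in C).
    replace (b + tsize g + 1) with be in * by lia.
    replace (be + tsize e + 1) with b0 in * by lia.
    replace (b0 + tsize p0 + 1) with b1 in * by lia.
    eapply reaches_le with (m := m + S (m' + S m'')); [|lia].
    eapply reaches_seq; [eapply IHtexec1; eauto|].
    intros c1 S1 E1. eapply reaches_jump;
      [rewrite E1; eassumption|reflexivity|eassumption|].
    intros c2 S2 E2.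
    destruct (t1 x1); [congruence| |]; cbn [pick] in *;
    (eapply reaches_seq; [eapply IHtexec2; eauto|];
     intros c3 S3 E3; eapply reaches_jump;
       [rewrite E3; eassumption|reflexivity|eassumption|];
     intros c4 S4 E4; eapply IHtexec3; eauto).
Qed.

(** * Stacks on the tape *)

(** The halting state is the exit of the code placed at 0; the default row also leads there, so no
    transition leaves the state set. *)
Definition machine (p : tcom) : TM :=
  {| tm_states := tsize p + 1;
     tm_start := 0;
     tm_halt := tsize p;
     tm_delta := fun q s => nth q (compile p 0) (jump (tsize p)) s |}.

Lemma machine_valid p : tm_valid (machine p).
Proof.
  repeat split; simpl; try lia.
  intros q s _. pose proof (compile_targets p 0) as F. unfold targets_le in F.
  destruct (nth_in_or_default q (compile p 0) (jump (tsize p))) as [I|E].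
  - rewrite Forall_forall in F. specialize (F _ I s). simpl in F. lia.
  - rewrite E; simpl; lia.
Qed.

Lemma machine_correct p t n t' x' c :
  texec p t 0 n t' x' -> c_state c = 0 -> shows c t 0 ->
  reaches (machine p) c n (tsize p) t' x'.
Proof.
  intros E Hq Hs. refine (compile_correct _ _ _ _ _ _ E (machine p) 0 c _ Hq Hs).
  intros i f Hi. simpl. split.
  - intros s. now rewrite (nth_error_nth _ _ _ Hi).
  - assert (i < length (compile p 0)) by (apply nth_error_Some; congruence).
    rewrite compile_length in *; lia.
Qed.

Definition state := list (list bool).

Definition get (i : nat) (s : state) : list bool := nth i s [].

Fixpoint upd (i : nat) (l : list bool) (s : state) : state :=
  match s, i with
  | [], _ => []
  | _ :: s, 0 => l :: s
  | a :: s, S i => a :: upd i l s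
  end.

Lemma upd_length i l s : length (upd i l s) = length s.
Proof. revert i; induction s; intros [|i]; simpl; auto. Qed.

Lemma get_upd_same i l s : i < length s -> get i (upd i l s) = l.
Proof.
  revert i; induction s; intros [|i] L; simpl in *; try lia; auto.
  apply IHs; lia.
Qed.

Lemma get_upd_other i j l s : i <> j -> get i (upd j l s) = get i s.
Proof.
  unfold get; revert i j; induction s; intros [|i] [|j] L; simpl in *; try lia; auto.
Qed.

Lemma upd_get i s : upd i (get i s) s = s.
Proof.
  unfold get; revert i; induction s; intros [|i]; simpl; f_equal; auto.
Qed.

Definition nstacks : nat := 12.

(* The stacks share the tape: stack 0 occupies the cells to the right of the home cell -1, and stack i > 0 the cells to its left at distance i modulo [nstacks]. Cell [pos i (S j)] holds the j-th symbol from the bottom of stack i, and [pos i 0] stays blank, so that walking back from the top stops there. *)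
Definition pos (i j : nat) : Z :=
  match i with
  | 0 => (Z.of_nat j - 1)%Z
  | _ => (-1 - (Z.of_nat i + Z.of_nat nstacks * Z.of_nat j))%Z
  end.

Definition away (i : nat) : move := match i with 0 => MoveR | _ => MoveL end.
Definition toward (i : nat) : move := match i with 0 => MoveL | _ => MoveR end.
Definition stride (i : nat) : nat := match i with 0 => 1 | _ => nstacks end.

Lemma pos_inj i j i' j' :
  i < nstacks -> i' < nstacks -> pos i (S j) = pos i' j' -> i = i' /\ S j = j'.
Proof.
  unfold pos, nstacks; destruct i, i'; lia.
Qed.

Lemma pos_home i : (pos i 0 + dz (toward i) * Z.of_nat i = -1)%Z.
Proof. unfold pos, toward; destruct i; simpl dz; lia. Qed.

Lemma pos_first i : (-1 + dz (away i) * Z.of_nat (i + stride i) = pos i 1)%Z.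
Proof. unfold pos, away, stride, nstacks; destruct i; simpl dz; lia. Qed.

Lemma pos_away i j m :
  (pos i j + dz (away i) * Z.of_nat (stride i) * Z.of_nat m = pos i (j + m))%Z.
Proof. unfold pos, away, stride, nstacks; destruct i; simpl dz; lia. Qed.

Lemma pos_toward i j m :
  (pos i (j + m) + dz (toward i) * Z.of_nat (stride i) * Z.of_nat m = pos i j)%Z.
Proof. unfold pos, toward, stride, nstacks; destruct i; simpl dz; lia. Qed.

Lemma pos_back i j : (pos i (S j) + dz (toward i) * Z.of_nat (stride i) = pos i j)%Z.
Proof. rewrite <- (pos_toward i j 1), Nat.add_1_r. lia. Qed.

Fixpoint moves (d : move) (m : nat) : tcom :=
  match m with 0 => TSkip | S m => TMv d ;; moves d m end.

Lemma moves_ok d m t x y :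
  (x + dz d * Z.of_nat m = y)%Z -> texec (moves d m) t x m t y.
Proof.
  revert x; induction m; intros x E; simpl.
  - replace y with x by lia. constructor.
  - eapply ESeq with (m := 1) (m' := m); [constructor; lia|apply IHm|lia]. lia.
Qed.

Definition walk (d : move) (m : nat) : tcom :=
  TLoop TSkip TSkip (moves d m) (moves d m).

Lemma walk_ok d m t k : forall x y,
  (x + dz d * Z.of_nat m * Z.of_nat k = y)%Z ->
  (forall j, j < k -> t (x + dz d * Z.of_nat m * Z.of_nat j)%Z <> Blank) ->
  t y = Blank ->
  texec (walk d m) t x (k * (m + 2) + 2) t y.
Proof.
  induction k; intros x y E F B.
  - replace y with x in * by lia.
    eapply EExit with (m := 0) (m' := 0); eauto using ESkip.
  - assert (N : t x <> Blank) by (specialize (F 0); rewrite Z.mul_0_r, Z.add_0_r in F; apply F; lia).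
    eapply ELoop with (m := 0) (m' := m); [constructor|exact N| |apply (IHk (x + dz d * Z.of_nat m)%Z)|].
    + destruct (t x); [congruence| |]; apply moves_ok; reflexivity.
    + lia.
    + intros j Hj. specialize (F (S j)).
      replace (x + dz d * Z.of_nat m + dz d * Z.of_nat m * Z.of_nat j)%Z
        with (x + dz d * Z.of_nat m * Z.of_nat (S j))%Z by lia. apply F; lia.
    + exact B.
    + lia.
Qed.

(** The head of a list is the top of its stack, hence [rev]. All cells above the top are blank,
    which is how the top is found, and why a pop has to erase its cell. *)
Definition trep (s : state) (t : tape) : Prop :=
  length s = nstacks /\
  forall i, i < nstacks -> t (pos i 0) = Blank /\
    forall j, t (pos i (S j)) = nth j (map sym_of_bool (rev (get i s))) Blank.

Lemma trep_full s t i j :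
  trep s t -> i < nstacks -> j < length (get i s) -> t (pos i (S j)) <> Blank.
Proof.
  intros [_ R] Hi Hj. destruct (R i Hi) as [_ R']. rewrite R'.
  rewrite nth_indep with (d' := sym_of_bool false)
    by (rewrite length_map, length_rev; auto).
  rewrite map_nth. destruct (nth j _ _); discriminate.
Qed.

Lemma trep_top s t i :
  trep s t -> i < nstacks -> t (pos i (S (length (get i s)))) = Blank.
Proof.
  intros [_ R] Hi. destruct (R i Hi) as [_ R']. rewrite R'.
  apply nth_overflow. now rewrite length_map, length_rev.
Qed.

Lemma trep_peek s t i b l :
  trep s t -> i < nstacks -> get i s = b :: l ->
  t (pos i (S (length l))) = sym_of_bool b.
Proof.
  intros [_ R] Hi E. destruct (R i Hi) as [_ R']. rewrite R', E. simpl.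
  rewrite map_app, app_nth2; rewrite length_map, length_rev; auto.
  now rewrite Nat.sub_diag.
Qed.

Lemma trep_push s t i b :
  trep s t -> i < nstacks ->
  trep (upd i (b :: get i s) s)
       (tput t (pos i (S (length (get i s)))) (sym_of_bool b)).
Proof.
  intros [L R] Hi. split; [now rewrite upd_length|].
  intros i' Hi'; unfold tput. destruct (R i' Hi') as [R0 R1]. split.
  - destruct (Z.eqb_spec (pos i' 0) (pos i (S (length (get i s))))) as [E|E]; auto.
    symmetry in E. apply pos_inj in E; auto. lia.
  - intros j. destruct (Z.eqb_spec (pos i' (S j)) (pos i (S (length (get i s))))) as [E|E].
    + apply pos_inj in E as [-> E]; auto.
      rewrite get_upd_same by lia. simpl. injection E as ->.
      rewrite map_app, app_nth2; rewrite length_map, length_rev; auto.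
      now rewrite Nat.sub_diag.
    + rewrite R1. destruct (Nat.eq_dec i' i) as [->|N].
      * rewrite get_upd_same by lia. simpl. rewrite map_app.
        destruct (Nat.lt_ge_cases j (length (get i s))).
        -- rewrite app_nth1; auto. now rewrite length_map, length_rev.
        -- assert (j <> length (get i s)) by congruence.
           rewrite !nth_overflow; auto; rewrite ?length_app, length_map, length_rev; simpl; lia.
      * now rewrite get_upd_other.
Qed.

Lemma trep_pop s t i b l :
  trep s t -> i < nstacks -> get i s = b :: l ->
  trep (upd i l s) (tput t (pos i (S (length l))) Blank).
Proof.
  intros [L R] Hi Es. split; [now rewrite upd_length|].
  intros i' Hi'; unfold tput. destruct (R i' Hi') as [R0 R1]. split.
  - destruct (Z.eqb_spec (pos i' 0) (pos i (S (length l)))) as [E|E]; auto.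
  - intros j. destruct (Z.eqb_spec (pos i' (S j)) (pos i (S (length l)))) as [E|E].
    + apply pos_inj in E as [-> E]; auto.
      rewrite get_upd_same by lia. rewrite nth_overflow; auto.
      rewrite length_map, length_rev; lia.
    + rewrite R1. destruct (Nat.eq_dec i' i) as [->|N].
      * rewrite get_upd_same by lia. rewrite Es. simpl. rewrite map_app.
        destruct (Nat.lt_ge_cases j (length l)).
        -- rewrite app_nth1; auto. now rewrite length_map, length_rev.
        -- assert (j <> length l) by congruence.
           rewrite !nth_overflow; auto; rewrite ?length_app, length_map, length_rev; simpl; lia.
      * now rewrite get_upd_other.
Qed.

(** * Stack operations as head movements *)

Definition to_free (i : nat) : tcom :=
  moves (away i) (i + stride i) ;; walk (away i) (stride i).

(** On an empty stack this ends on the blank cell [pos i 0], so that a single look at the cell both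
    tests for emptiness and reads the top bit. *)
Definition to_top (i : nat) : tcom := to_free i ;; moves (toward i) (stride i).

Definition to_home (i : nat) : tcom :=
  moves (toward i) (stride i) ;; walk (toward i) (stride i) ;; moves (toward i) i.

Lemma stride_le i : stride i <= 12.
Proof. unfold stride, nstacks; destruct i; lia. Qed.

Lemma to_free_ok s t i :
  trep s t -> i < nstacks ->
  texec (to_free i) t (-1) (25 + 14 * length (get i s)) t (pos i (S (length (get i s)))).
Proof.
  intros R Hi. pose proof (stride_le i). unfold nstacks in Hi.
  eapply ESeq; [apply moves_ok, pos_first|
    apply (walk_ok _ _ _ (length (get i s)))|nia].
  - apply (pos_away i 1).
  - intros j Hj. rewrite pos_away. eapply trep_full; eauto.
  - eapply trep_top; eauto.
Qed.

Lemma to_top_ok s t i :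
  trep s t -> i < nstacks ->
  texec (to_top i) t (-1) (37 + 14 * length (get i s)) t (pos i (length (get i s))).
Proof.
  intros R Hi. pose proof (stride_le i).
  eapply ESeq; [apply to_free_ok; eauto| |].
  - apply moves_ok, pos_back.
  - lia.
Qed.

(** The starting cell may hold any [v]: a push has just written it, or a pop has erased it. The walk
    begins one stride below. *)
Lemma to_home_ok s t i h v :
  trep s t -> i < nstacks -> h <= length (get i s) ->
  texec (to_home i) (tput t (pos i (S h)) v) (pos i (S h)) (26 + 14 * h)
    (tput t (pos i (S h)) v) (-1).
Proof.
  intros R Hi Hh. pose proof (stride_le i). unfold nstacks in Hi.
  assert (P : forall j, j <= h -> tput t (pos i (S h)) v (pos i j) = t (pos i j)).
  { intros j Hj. unfold tput. destruct (Z.eqb_spec (pos i j) (pos i (S h))) as [E|E]; auto.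
    symmetry in E; apply pos_inj in E; unfold nstacks; auto; lia. }
  assert (T : forall k, k <= h ->
    (pos i h + dz (toward i) * Z.of_nat (stride i) * Z.of_nat k = pos i (h - k))%Z).
  { intros k Hk. replace h with (h - k + k) at 1 by lia. apply pos_toward. }
  eapply ESeq; [apply moves_ok with (y := pos i h)|
    eapply ESeq; [apply (walk_ok _ _ _ h) with (y := pos i 0)|
                  apply moves_ok, pos_home|]|].
  - apply pos_back.
  - rewrite T by lia. now rewrite Nat.sub_diag.
  - intros j Hj. rewrite T by lia. rewrite P by lia.
    replace (h - j) with (S (h - S j)) by lia. eapply trep_full; eauto. lia.
  - rewrite P by lia. now apply R.
  - reflexivity.
  - nia.
Qed.

(* [sexec p s n s']: [p] uses at most [n] stack operations to go from [s] to [s']; an operation costs time proportional to the height of the stacks, which [n] operations raise by at most [n]. *)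
Definition sexec (p : tcom) (s : state) (n : nat) (s' : state) : Prop :=
  forall t h, trep s t -> (forall i, length (get i s) <= h) ->
  exists t', trep s' t' /\ (forall i, length (get i s') <= h + n) /\
    texec p t (-1) (100 * n * (h + n)) t' (-1).

Definition push (i : nat) (b : bool) : tcom :=
  to_free i ;; TWr (sym_of_bool b) ;; to_home i.

Definition popcase (i : nat) (pe p0 p1 : tcom) : tcom :=
  to_top i ;; TCase (moves (toward i) i ;; pe)
    (TWr Blank ;; to_home i ;; p0) (TWr Blank ;; to_home i ;; p1).

Definition poploop (i : nat) (p0 p1 : tcom) : tcom :=
  TLoop (to_top i) (moves (toward i) i)
    (TWr Blank ;; to_home i ;; p0) (TWr Blank ;; to_home i ;; p1).

Lemma upd_heights i l s h k :
  (forall j, length (get j s) <= h) -> length l <= h + k ->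
  forall j, length (get j (upd i l s)) <= h + k.
Proof.
  intros Hh Hl j. destruct (Nat.eq_dec j i) as [E|N]; [subst j|].
  - destruct (Nat.lt_ge_cases i (length s)).
    + now rewrite get_upd_same.
    + unfold get; rewrite nth_overflow; simpl; [lia|]. now rewrite upd_length.
  - rewrite get_upd_other; auto. specialize (Hh j); lia.
Qed.

Lemma sexec_le p s n s' m : sexec p s n s' -> n <= m -> sexec p s m s'.
Proof.
  intros E L t h R Hh. destruct (E t h R Hh) as (t' & R' & Hh' & E').
  exists t'; split; [exact R'|split].
  - intros i; specialize (Hh' i); lia.
  - eapply texec_le; [exact E'|nia].
Qed.

Lemma s_skip s : sexec TSkip s 0 s.
Proof.
  intros t h R Hh. exists t; split; [exact R|split].
  - intros i; specialize (Hh i); lia.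
  - constructor.
Qed.

(** The shape of the cost is closed under sequencing: [q] starts from heights at most [h + n1], and
    [n1 * (h + n1) + n2 * (h + n1 + n2) <= (n1 + n2) * (h + n1 + n2)]. *)
Lemma s_seq p q s n1 s1 n2 s2 n :
  sexec p s n1 s1 -> sexec q s1 n2 s2 -> n1 + n2 <= n -> sexec (p ;; q) s n s2.
Proof.
  intros E1 E2 L. eapply sexec_le; [|exact L]. intros t h R Hh.
  destruct (E1 t h R Hh) as (t1 & R1 & Hh1 & E1').
  destruct (E2 t1 (h + n1) R1 Hh1) as (t2 & R2 & Hh2 & E2').
  exists t2; split; [exact R2|split].
  - intros i; specialize (Hh2 i); lia.
  - eapply ESeq; eauto. nia.
Qed.

Lemma s_push i b s : i < nstacks -> sexec (push i b) s 1 (upd i (b :: get i s) s).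
Proof.
  intros Hi t h R Hh. specialize (trep_push s t i b R Hi) as R1.
  eexists; split; [exact R1|split].
  - apply upd_heights; auto. simpl. specialize (Hh i); lia.
  (* The two walks and the write take at most [52 + 28 * h] steps, within the allowed
     [100 * (h + 1)]. *)
  - specialize (Hh i). eapply ESeq; [apply to_free_ok; eauto|
      eapply ESeq; [apply EWr, le_n|eapply to_home_ok; eauto|reflexivity]|].
    lia.
Qed.

Lemma pop_ok i b l s t p n h t' :
  trep s t -> i < nstacks -> get i s = b :: l -> (forall i, length (get i s) <= h) ->
  texec p (tput t (pos i (length (get i s))) Blank) (-1) n t' (-1) ->
  texec (TWr Blank ;; to_home i ;; p) t (pos i (length (get i s))) (30 + 14 * h + n) t' (-1).
Proof.
  intros R Hi E Hh E1. specialize (Hh i). rewrite E in *; simpl in *.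
  eapply ESeq; [apply EWr, le_n|eapply ESeq; [eapply to_home_ok; eauto|exact E1|reflexivity]|].
  - rewrite E; simpl; lia.
  - lia.
Qed.

Lemma s_case_nil i pe p0 p1 s n s' :
  i < nstacks -> get i s = [] -> sexec pe s n s' -> sexec (popcase i pe p0 p1) s (S n) s'.
Proof.
  intros Hi E Ee t h R Hh. destruct (Ee t h R Hh) as (t' & R' & Hh' & E').
  exists t'; split; [exact R'|split].
  - intros j; specialize (Hh' j); lia.
  - pose proof (Hh i) as Hhi. unfold nstacks in Hi.
    eapply ESeq; [apply to_top_ok; eauto| |].
    + rewrite E; simpl. eapply ECase; [|reflexivity].
      replace (t (pos i 0)) with Blank by (symmetry; now apply R). simpl.
      eapply ESeq; [apply moves_ok, pos_home|exact E'|reflexivity].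
    + nia.
Qed.

Lemma s_case_cons i b l pe p0 p1 s n s' :
  i < nstacks -> get i s = b :: l -> sexec (if b then p1 else p0) (upd i l s) n s' ->
  sexec (popcase i pe p0 p1) s (S n) s'.
Proof.
  intros Hi E Ee t h R Hh.
  destruct (Ee _ h (trep_pop _ _ _ _ _ R Hi E)) as (t' & R' & Hh' & E').
  { pose proof (Hh i) as Hhi; rewrite E in Hhi; simpl in Hhi.
    replace h with (h + 0) by lia. apply upd_heights; auto; lia. }
  exists t'; split; [exact R'|split].
  - intros j; specialize (Hh' j); lia.
  - pose proof (Hh i) as Hhi.
    eapply ESeq with (m' := 32 + 14 * h + 100 * n * (h + n)); [apply to_top_ok; eauto| |nia].
    eapply ECase with (m := 30 + 14 * h + 100 * n * (h + n)); [|lia].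
    assert (P : t (pos i (length (get i s))) = sym_of_bool b)
      by (rewrite E; eapply trep_peek; eauto).
    rewrite P. destruct b; simpl; eapply pop_ok; eauto; now rewrite E.
Qed.

Lemma s_loop_nil i p0 p1 s :
  i < nstacks -> get i s = [] -> sexec (poploop i p0 p1) s 1 s.
Proof.
  intros Hi E t h R Hh.
  exists t; split; [exact R|split].
  - intros j; specialize (Hh j); lia.
  - pose proof (Hh i) as Hhi. unfold nstacks in Hi.
    eapply EExit; [apply to_top_ok; eauto|rewrite E; now apply R|
      rewrite E; apply moves_ok, pos_home|]. lia.
Qed.

Lemma s_loop_cons i b l p0 p1 s n1 s1 n2 s2 n :
  i < nstacks -> get i s = b :: l -> sexec (if b then p1 else p0) (upd i l s) n1 s1 ->
  sexec (poploop i p0 p1) s1 n2 s2 -> S (n1 + n2) <= n ->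
  sexec (poploop i p0 p1) s n s2.
Proof.
  intros Hi E E1 E2 L. eapply sexec_le; [|exact L]. clear n L. intros t h R Hh.
  destruct (E1 _ h (trep_pop _ _ _ _ _ R Hi E)) as (t1 & R1 & Hh1 & E1').
  { pose proof (Hh i) as Hhi; rewrite E in Hhi; simpl in Hhi.
    replace h with (h + 0) by lia. apply upd_heights; auto; lia. }
  destruct (E2 t1 (h + n1) R1 Hh1) as (t2 & R2 & Hh2 & E2').
  exists t2; split; [exact R2|split].
  - intros j; specialize (Hh2 j); lia.
  - pose proof (Hh i) as Hhi.
    assert (P : t (pos i (length (get i s))) = sym_of_bool b)
      by (rewrite E; eapply trep_peek; eauto).
    eapply ELoop with (m' := 30 + 14 * h + 100 * n1 * (h + n1));
      [apply to_top_ok; eauto|rewrite P; destruct b; discriminate| |exact E2'|nia].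
    rewrite P. destruct b; simpl; eapply pop_ok; eauto; now rewrite E.
Qed.

(** * From stack programs to machines *)

Definition start_state (x : list bool) : state :=
  rev x :: repeat [] 11.

(** The input word on the tape already is stack 0, with its first bit at the bottom in cell 0. The
    added moves lead from that cell to the home cell and back, so that [output] reads stack 0 from
    its bottom. *)
Definition from_stacks (p : tcom) : TM := machine (TMv MoveL ;; p ;; TMv MoveR).

Lemma nth_blank (l : list sym) i : (forall s, In s l -> s = Blank) -> nth i l Blank = Blank.
Proof.
  intros H. destruct (nth_in_or_default i l Blank); auto.
Qed.

Lemma read_word_nth y : forall l,
  (forall j, nth j l Blank = nth j (map sym_of_bool y) Blank) -> read_word l = y.
Proof.
  induction y as [|b y IH]; intros l H.
  - specialize (H 0). destruct l as [|[] l]; simpl in *; auto; discriminate.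
  - pose proof (H 0) as H0. destruct l as [|a l]; [destruct b; discriminate|].
    simpl in H0; subst a.
    assert (read_word l = y) by (apply IH; intros j; apply (H (S j))).
    destruct b; simpl; congruence.
Qed.

Theorem from_stacks_correct p x n y s :
  sexec p (start_state x) n s -> get 0 s = rev y ->
  runs_within (from_stacks p) x (100 * n * (length x + n) + 2) y.
Proof.
  intros E Es.
  set (t := fun z => if (z <? 0)%Z then Blank else nth (Z.to_nat z) (map sym_of_bool x) Blank).
  assert (TB : forall z, (z < 0)%Z -> t z = Blank)
    by (intros z Hz; unfold t; now rewrite (proj2 (Z.ltb_lt _ _) Hz)).
  assert (TN : forall j, t (Z.of_nat j) = nth j (map sym_of_bool x) Blank)
    by (intros j; unfold t; destruct (Z.ltb_spec (Z.of_nat j) 0); [lia|now rewrite Nat2Z.id]).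
  destruct (E t (length x)) as (t' & [_ R'] & _ & E').
  - split; [reflexivity|]. intros [|i] Hi; (split; [apply TB; unfold pos; lia|]); intros j.
    + change (get 0 (start_state x)) with (rev x). rewrite rev_involutive, <- TN.
      unfold pos; f_equal; lia.
    + rewrite TB by (unfold pos; lia). symmetry. apply nth_blank.
      unfold nstacks in Hi. do 11 (destruct i as [|i]; [simpl; tauto|]). lia.
  - intros [|i]; [apply Nat.eq_le_incl, length_rev|].
    do 11 (destruct i as [|i]; [simpl; lia|]).
    unfold get; rewrite nth_overflow; simpl; lia.
  - assert (S0 : shows (init (from_stacks p) x) t 0).
    { unfold init. split; [|split].
      - transitivity (nth 0 (map sym_of_bool x) Blank); [|symmetry; apply (TN 0)].
        destruct (map sym_of_bool x); reflexivity.
      - intros i. replace (0 + 1 + Z.of_nat i)%Z with (Z.of_nat (S i)) by lia. rewrite TN.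
        destruct (map sym_of_bool x); destruct i; reflexivity.
      - intros i. rewrite TB by lia. destruct (map sym_of_bool x); destruct i; reflexivity. }
    destruct (machine_correct (TMv MoveL ;; p ;; TMv MoveR) t
                (100 * n * (length x + n) + 2) t' 0 (init (from_stacks p) x))
      as (k & Hk & Q & S1).
    + eapply ESeq; [apply (EMv MoveL), le_n|eapply ESeq; [exact E'|apply (EMv MoveR), le_n|reflexivity]|lia].
    + unfold init; destruct (map sym_of_bool x); reflexivity.
    + exact S0.
    + exists k; split; [exact Hk|split; [exact Q|]].
      unfold output. apply read_word_nth. intros j.
      destruct (R' 0) as [_ R0]; [unfold nstacks; lia|].
      specialize (R0 j). rewrite Es, rev_involutive in R0. rewrite <- R0.
      destruct S1 as (H1 & H2 & _). unfold pos, from_stacks in *.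
      destruct j; simpl nth; [rewrite H1|rewrite H2]; f_equal; lia.
Qed.

(** * Stack programs *)

(* D: input, processed matrix entries, and finally output; A: adjacency matrix; R: remaining vertices; S: current vertex set; X, C, T: scratch; W, L, Q: tape and state of the simulated machine; Y: its output; F: flag of the main loop. *)
Notation kD := 0 (only parsing).
Notation kA := 1 (only parsing).
Notation kR := 2 (only parsing).
Notation kS := 3 (only parsing).
Notation kX := 4 (only parsing).
Notation kC := 5 (only parsing).
Notation kT := 6 (only parsing).
Notation kW := 7 (only parsing).
Notation kL := 8 (only parsing).
Notation kQ := 9 (only parsing).
Notation kY := 10 (only parsing).
Notation kF := 11 (only parsing).
Notation St d a r s x c t w l q y f :=
  (d :: a :: r :: s :: x :: c :: t :: w :: l :: q :: y :: f :: @nil (list bool))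
  (only parsing).

Lemma s_eq p s n s1 s2 m : sexec p s n s1 -> s1 = s2 -> n <= m -> sexec p s m s2.
Proof. intros E <- L; eapply sexec_le; eauto. Qed.

Lemma state_ext (s1 s2 : state) :
  length s1 = length s2 -> (forall i, get i s1 = get i s2) -> s1 = s2.
Proof. intros L E; apply (nth_ext _ _ [] [] L); intros i _; apply E. Qed.

Definition mv (i j : nat) : tcom := poploop i (push j false) (push j true).

Lemma s_mv i j s : length s = nstacks -> i < nstacks -> j < nstacks -> i <> j ->
  sexec (mv i j) s (2 * length (get i s) + 1)
    (upd i [] (upd j (rev_append (get i s) (get j s)) s)).
Proof.
  intros Ls Hi Hj N. remember (get i s) as l eqn:E. revert s Ls E.
  induction l as [|b l IH]; intros s Ls E.
  - simpl. replace (upd i [] (upd j (get j s) s)) with s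
      by (rewrite upd_get, E; symmetry; apply upd_get).
    apply s_loop_nil; auto.
  - assert (EP : sexec (if b then push j true else push j false) (upd i l s) 1
                   (upd j (b :: get j (upd i l s)) (upd i l s)))
      by (destruct b; apply s_push; auto).
    eapply s_loop_cons; [exact Hi|symmetry; exact E|exact EP| |].
    + eapply s_eq; [apply IH| |apply le_n].
      * now rewrite !upd_length.
      * rewrite get_upd_other, get_upd_same; auto; lia.
      * apply state_ext; [now rewrite !upd_length|]. intros k.
        destruct (Nat.eq_dec k i) as [->|Ni];
          [rewrite !get_upd_same; rewrite ?upd_length; auto; lia|].
        rewrite !(get_upd_other k i) by auto.
        destruct (Nat.eq_dec k j) as [->|Nj].
        -- rewrite !get_upd_same; rewrite ?upd_length; try lia.
           rewrite get_upd_other by auto. reflexivity.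
        -- now rewrite !get_upd_other by auto.
    + simpl; lia.
Qed.

Definition clear (i : nat) : tcom := poploop i TSkip TSkip.

Lemma s_clear i s : length s = nstacks -> i < nstacks ->
  sexec (clear i) s (length (get i s) + 1) (upd i [] s).
Proof.
  intros Ls Hi. remember (get i s) as l eqn:E. revert s Ls E.
  induction l as [|b l IH]; intros s Ls E.
  - replace (upd i [] s) with s by (rewrite E; symmetry; apply upd_get).
    apply s_loop_nil; auto.
  - eapply s_loop_cons with (n1 := 0);
      [exact Hi|symmetry; exact E|destruct b; apply s_skip|eapply s_eq; [apply IH| |apply le_n]|].
    + now rewrite upd_length.
    + rewrite get_upd_same; auto; lia.
    + apply state_ext; [now rewrite !upd_length|]. intros k.
      destruct (Nat.eq_dec k i) as [->|Ni];
        [rewrite !get_upd_same; rewrite ?upd_length; auto; lia|].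
      now rewrite !get_upd_other by auto.
    + simpl; lia.
Qed.

(** Symbolic execution of straight-line code on twelve explicit stacks. Loops other than [mv] and
    [clear] need an induction and are left as goals. *)
Ltac sx :=
  cbn [get upd nth app];
  lazymatch goal with
  | |- sexec TSkip _ _ _ => apply s_skip
  | |- sexec (push _ _) _ _ _ => apply s_push; unfold nstacks; lia
  | |- sexec (mv _ _) _ _ _ => apply s_mv; [reflexivity|unfold nstacks; lia|unfold nstacks; lia|lia]
  | |- sexec (clear _) _ _ _ => apply s_clear; [reflexivity|unfold nstacks; lia]
  | |- sexec (_ ;; _) _ _ _ => eapply s_seq; [sx|sx|apply le_n]
  | |- sexec (popcase _ _ _ _) _ _ _ =>
      first [eapply s_case_nil; [unfold nstacks; lia|reflexivity|sx]
            |eapply s_case_cons; [unfold nstacks; lia|reflexivity|cbv beta iota; sx]]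
  | |- _ => idtac
  end.

Ltac sxl := eapply sexec_le; [sx|simpl; lia].

Ltac loop_nil := apply s_loop_nil; [unfold nstacks; lia|reflexivity].
Tactic Notation "loop_cons" constr(k) "using" tactic3(ih) :=
  eapply s_loop_cons with (n1 := k);
  [unfold nstacks; lia|reflexivity| |ih|]; cbn [upd get nth].

(** * Extracting a submatrix *)

Fixpoint sel {A : Type} (m : list bool) (l : list A) : list A :=
  match m, l with
  | b :: m, a :: l => if b then a :: sel m l else sel m l
  | _, _ => []
  end.

Definition take_entry : tcom := popcase kA TSkip (push kD false) (push kD true).

Definition skip_row : tcom :=
  poploop kS (push kX false ;; take_entry) (push kX true ;; take_entry) ;; mv kX kS.

Definition keep_entry : tcom :=
  popcase kA TSkip (push kD false ;; push kT false) (push kD true ;; push kT true).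

Definition keep_row : tcom :=
  poploop kS (push kX false ;; take_entry) (push kX true ;; keep_entry) ;; mv kX kS.

Lemma skip_row_loop m : forall d rest r x c t w l q y f row, length row = length m ->
  sexec (poploop kS (push kX false ;; take_entry) (push kX true ;; take_entry))
    (St d (row ++ rest) r m x c t w l q y f) (4 * length m + 1)
    (St (rev_append row d) rest r [] (rev_append m x) c t w l q y f).
Proof.
  induction m as [|b m IH]; intros d rest r x c t w l q y f [|a row] Lr; try discriminate.
  - loop_nil.
  - loop_cons 3 using (apply (IH (a :: d) rest r (b :: x)); auto).
    + destruct b, a; unfold take_entry; sx.
    + simpl; lia.
Qed.

Lemma s_skip_row d rest r m c t w l q y f row : length row = length m ->
  sexec skip_row (St d (row ++ rest) r m [] c t w l q y f) (6 * length m + 2)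
    (St (rev_append row d) rest r m [] c t w l q y f).
Proof.
  intros Lr. eapply s_eq; [unfold skip_row; eapply s_seq;
    [apply skip_row_loop; auto|sx|apply le_n]| |]; cbn [upd get nth].
  - now rewrite !rev_append_rev, !app_nil_r, rev_involutive.
  - rewrite rev_append_rev, app_nil_r, length_rev. lia.
Qed.

Lemma keep_row_loop m : forall d rest r x c t w l q y f row, length row = length m ->
  sexec (poploop kS (push kX false ;; take_entry) (push kX true ;; keep_entry))
    (St d (row ++ rest) r m x c t w l q y f) (5 * length m + 1)
    (St (rev_append row d) rest r [] (rev_append m x) c (rev_append (sel m row) t) w l q y f).
Proof.
  induction m as [|b m IH]; intros d rest r x c t w l q y f [|a row] Lr; try discriminate.
  - loop_nil.
  - destruct b.
    + loop_cons 4 using (apply (IH (a :: d) rest r (true :: x) c (a :: t)); auto);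
        [destruct a; unfold keep_entry; sxl|simpl; lia].
    + loop_cons 4 using (apply (IH (a :: d) rest r (false :: x) c t); auto);
        [destruct a; unfold take_entry; sxl|simpl; lia].
Qed.

Lemma s_keep_row d rest r m c t w l q y f row : length row = length m ->
  sexec keep_row (St d (row ++ rest) r m [] c t w l q y f) (7 * length m + 2)
    (St (rev_append row d) rest r m [] c (rev_append (sel m row) t) w l q y f).
Proof.
  intros Lr. eapply s_eq; [unfold keep_row; eapply s_seq;
    [apply keep_row_loop; auto|sx|apply le_n]| |]; cbn [upd get nth].
  - now rewrite !rev_append_rev, !app_nil_r, rev_involutive.
  - rewrite rev_append_rev, app_nil_r, length_rev. lia.
Qed.

(* Stack C selects the rows and stack S the columns of the matrix in stack A. *)
Definition extract : tcom := poploop kC skip_row keep_row ;; mv kD kA.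

Lemma extract_loop m cs : forall d rest r t w l q y f rows,
  length rows = length cs -> Forall (fun row => length row = length m) rows ->
  sexec (poploop kC skip_row keep_row)
    (St d (concat rows ++ rest) r m [] cs t w l q y f) (length cs * (7 * length m + 3) + 1)
    (St (rev_append (concat rows) d) rest r m [] []
        (rev_append (concat (map (sel m) (sel cs rows))) t) w l q y f).
Proof.
  induction cs as [|b cs IH]; intros d rest r t w l q y f [|row rows] Lr F; try discriminate.
  - loop_nil.
  - inversion F; subst; simpl in Lr.
    assert (RA : forall u v z : list bool, rev_append (u ++ v) z = rev_append v (rev_append u z))
      by (intros; rewrite !rev_append_rev, rev_app_distr, app_assoc; reflexivity).
    cbn [concat]; rewrite RA, <- app_assoc.
    destruct b; cbn [sel map concat]; rewrite ?RA.
    + loop_cons (7 * length m + 2) using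
        (apply (IH (rev_append row d) rest r (rev_append (sel m row) t)); auto);
        [apply s_keep_row; auto|simpl; lia].
    + loop_cons (7 * length m + 2) using
        (apply (IH (rev_append row d) rest r t); auto);
        [eapply sexec_le; [apply s_skip_row; auto|lia]|simpl; lia].
Qed.

(** The submatrix lands on T in reverse. Popping it onto W in [feed] restores the order, and [check]
    does not depend on the order. *)
Lemma s_extract r m cs t w l q y f rows :
  length rows = length cs -> Forall (fun row => length row = length m) rows ->
  sexec extract
    (St [] (concat rows) r m [] cs t w l q y f)
    (length cs * (7 * length m + 3) + 2 * length (concat rows) + 2)
    (St [] (concat rows) r m [] []
        (rev_append (concat (map (sel m) (sel cs rows))) t) w l q y f).
Proof.
  intros Lr F. pose proof (extract_loop m cs [] [] r t w l q y f rows Lr F) as E.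
  rewrite app_nil_r in E.
  eapply s_eq; [unfold extract; eapply s_seq; [exact E|sx|apply le_n]| |]; cbn [upd get nth].
  - now rewrite !rev_append_rev, !app_nil_r, rev_involutive.
  - rewrite rev_append_rev, app_nil_r, length_rev. lia.
Qed.

Lemma rev_append_twice {A : Type} (l : list A) : rev_append (rev_append l []) [] = l.
Proof. now rewrite !rev_append_rev, !app_nil_r, rev_involutive. Qed.

Lemma rev_append_length {A : Type} (l m : list A) :
  length (rev_append l m) = length l + length m.
Proof. now rewrite rev_append_rev, length_app, length_rev. Qed.

(** * Reading the matrix and finding its dimension *)

Definition take_input : tcom := popcase kD TSkip (push kA false) (push kA true).

Definition take_inputs : tcom :=
  poploop kR (push kX true ;; take_input) (push kX true ;; take_input) ;; mv kX kR.

(* n^2 is the sum of the first n odd numbers: stack R grows by one each time that 2|R| + 1 bits have been read. *)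
Definition measure : tcom :=
  poploop kD (push kA false ;; take_inputs ;; take_inputs ;; push kR true)
             (push kA true ;; take_inputs ;; take_inputs ;; push kR true).

Lemma take_inputs_loop i : forall u v a s x c t w l q y f, length u = i ->
  sexec (poploop kR (push kX true ;; take_input) (push kX true ;; take_input))
    (St (u ++ v) a (repeat true i) s x c t w l q y f) (4 * i + 1)
    (St v (rev_append u a) [] s (rev_append (repeat true i) x) c t w l q y f).
Proof.
  induction i as [|i IH]; intros [|b u] v a s x c t w l q y f Lu; try discriminate.
  - loop_nil.
  - cbn [repeat app]. loop_cons 3 using (apply (IH u v (b :: a) s (true :: x)); auto).
    + destruct b; unfold take_input; sxl.
    + lia.
Qed.

Lemma s_take_inputs i u v a s c t w l q y f : length u = i ->
  sexec take_inputs
    (St (u ++ v) a (repeat true i) s [] c t w l q y f) (6 * i + 2)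
    (St v (rev_append u a) (repeat true i) s [] c t w l q y f).
Proof.
  intros Lu. eapply s_eq; [unfold take_inputs; eapply s_seq;
    [apply take_inputs_loop; auto|sx|apply le_n]| |]; cbn [upd get nth].
  - now rewrite rev_append_twice.
  - rewrite rev_append_length, repeat_length; simpl; lia.
Qed.

(** After [i] rounds [i * i] bits have been consumed, and the hypothesis says that exactly [j]
    rounds remain. Popping the input reverses it, which brings its first bit to the top of A. *)
Lemma s_measure s c t w l q y f j : forall i d a,
  length d + i * i = (i + j) * (i + j) ->
  sexec measure
    (St d a (repeat true i) s [] c t w l q y f) (j * (12 * (i + j) + 8) + 1)
    (St [] (rev_append d a) (repeat true (i + j)) s [] c t w l q y f).
Proof.
  induction j as [|j IH]; intros i d a Ld.
  - rewrite Nat.add_0_r. destruct d; [|simpl in Ld; lia]. loop_nil.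
  - destruct d as [|b d]; [simpl in Ld; lia|].
    (* The loop itself has popped one of the [2 * i + 1] bits of this round; the two calls of
       [take_inputs] read [i] bits each. *)
    assert (Ld' : length d = i + (i + (length d - 2 * i))) by (simpl in Ld; lia).
    rewrite <- (firstn_skipn i d) at 1. rewrite <- (firstn_skipn i (skipn i d)).
    set (u1 := firstn i d). set (u2 := firstn i (skipn i d)). set (v := skipn i (skipn i d)).
    assert (L1 : length u1 = i) by (unfold u1; rewrite length_firstn; lia).
    assert (L2 : length u2 = i) by (unfold u2; rewrite length_firstn, length_skipn; lia).
    assert (L3 : length v = length d - 2 * i) by (unfold v; rewrite !length_skipn; lia).
    assert (E : rev_append v (rev_append u2 (rev_append u1 (b :: a))) = rev_append (b :: d) a).
    { rewrite <- (firstn_skipn i d). fold u1. rewrite <- (firstn_skipn i (skipn i d)).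
      fold u2 v. rewrite !rev_append_rev. simpl. rewrite !rev_app_distr, <- !app_assoc. reflexivity. }
    rewrite <- E. replace (i + S j) with (S i + j) by lia.
    loop_cons (1 + (6 * i + 2) + (6 * i + 2) + 1) using
      (apply (IH (S i) v (rev_append u2 (rev_append u1 (b :: a)))); simpl in Ld; simpl; lia).
    + assert (R : sexec (take_inputs ;; take_inputs ;; push kR true)
                   (St (u1 ++ u2 ++ v) (b :: a) (repeat true i) s [] c t w l q y f)
                   ((6 * i + 2) + (6 * i + 2) + 1)
                   (St v (rev_append u2 (rev_append u1 (b :: a))) (repeat true (S i)) s [] c t w l q y f)).
      { eapply s_seq; [apply s_take_inputs; auto|
          eapply s_seq; [apply s_take_inputs; auto|sx|apply le_n]|lia]. }
      destruct b; (eapply s_seq; [sx|exact R|lia]).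
    + nia.
Qed.

Definition copy_mask : tcom :=
  mv kR kX ;;
  poploop kX (push kR false ;; push kS false ;; push kC false)
             (push kR true ;; push kS true ;; push kC true).

Lemma copy_mask_loop m : forall d a r s c t w l q y f,
  sexec (poploop kX (push kR false ;; push kS false ;; push kC false)
                    (push kR true ;; push kS true ;; push kC true))
    (St d a r s m c t w l q y f) (4 * length m + 1)
    (St d a (rev_append m r) (rev_append m s) [] (rev_append m c) t w l q y f).
Proof.
  induction m as [|b m IH]; intros d a r s c t w l q y f; [loop_nil|].
  loop_cons 3 using (apply (IH d a (b :: r) (b :: s) (b :: c))).
  - destruct b; sxl.
  - simpl; lia.
Qed.

Lemma s_copy_mask d a r t w l q y f :
  sexec copy_mask (St d a r [] [] [] t w l q y f) (6 * length r + 2)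
    (St d a r r [] r t w l q y f).
Proof.
  eapply s_eq; [unfold copy_mask; eapply s_seq;
    [sx|cbn [upd get nth]; apply copy_mask_loop|apply le_n]| |]; cbn [upd get nth].
  - now rewrite rev_append_twice.
  - rewrite rev_append_length; simpl; lia.
Qed.

Definition copy_set : tcom :=
  mv kS kX ;;
  poploop kX (push kS false ;; push kC false) (push kS true ;; push kC true).

Lemma copy_set_loop m : forall d a r s c t w l q y f,
  sexec (poploop kX (push kS false ;; push kC false) (push kS true ;; push kC true))
    (St d a r s m c t w l q y f) (3 * length m + 1)
    (St d a r (rev_append m s) [] (rev_append m c) t w l q y f).
Proof.
  induction m as [|b m IH]; intros d a r s c t w l q y f; [loop_nil|].
  loop_cons 2 using (apply (IH d a r (b :: s) (b :: c))).
  - destruct b; sxl.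
  - simpl; lia.
Qed.

Lemma s_copy_set d a r s t w l q y f :
  sexec copy_set (St d a r s [] [] t w l q y f) (5 * length s + 2)
    (St d a r s [] s t w l q y f).
Proof.
  eapply s_eq; [unfold copy_set; eapply s_seq;
    [sx|cbn [upd get nth]; apply copy_set_loop|apply le_n]| |]; cbn [upd get nth].
  - now rewrite rev_append_twice.
  - rewrite rev_append_length; simpl; lia.
Qed.

(** * Simulating the given machine *)

Definition esym (a : sym) : list bool :=
  match a with Blank => [false] | Zero => [true; false] | One => [true; true] end.

Definition esyms (l : list sym) : list bool := flat_map esym l.

Definition feed : tcom :=
  poploop kT (push kW false ;; push kW true) (push kW true ;; push kW true).

Lemma feed_loop m : forall d a r s x c z l q y f,
  sexec feed (St d a r s x c m (esyms (map sym_of_bool z)) l q y f) (3 * length m + 1)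
    (St d a r s x c [] (esyms (map sym_of_bool (rev_append m z))) l q y f).
Proof.
  induction m as [|b m IH]; intros d a r s x c z l q y f; [loop_nil|].
  loop_cons 2 using (apply (IH d a r s x c (b :: z))).
  - destruct b; cbn [map sym_of_bool esyms flat_map esym app]; fold (esyms (map sym_of_bool z)); sxl.
  - simpl; lia.
Qed.

Fixpoint pushn (i n : nat) : tcom :=
  match n with 0 => TSkip | S n => push i true ;; pushn i n end.

Lemma upd_upd i l l' s : upd i l (upd i l' s) = upd i l s.
Proof. revert i; induction s; intros [|i]; simpl; f_equal; auto. Qed.

Lemma s_pushn i n s : length s = nstacks -> i < nstacks ->
  sexec (pushn i n) s n (upd i (repeat true n ++ get i s) s).
Proof.
  revert s; induction n as [|n IH]; intros s Ls Hi.
  - simpl. rewrite upd_get. apply s_skip.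
  - eapply s_eq; [eapply s_seq; [apply s_push; exact Hi|apply IH|apply le_n]| |lia]; auto.
    + now rewrite upd_length.
    + rewrite upd_upd, get_upd_same by lia. f_equal.
      change (true :: get i s) with ([true] ++ get i s). rewrite app_assoc.
      f_equal. symmetry; apply repeat_cons.
Qed.

(** The bits of the prefix code [esym] are pushed last bit first, so that a reader meets them in
    order from the top. *)
Definition writesym (i : nat) (a : sym) : tcom :=
  match a with
  | Blank => push i false
  | Zero => push i false ;; push i true
  | One => push i true ;; push i true
  end.

Lemma s_writesym i a s : length s = nstacks -> i < nstacks ->
  sexec (writesym i a) s 2 (upd i (esym a ++ get i s) s).
Proof.
  intros Ls Hi.
  assert (P : forall b b', sexec (push i b ;; push i b') s 2 (upd i (b' :: b :: get i s) s)).
  { intros b b'. eapply s_eq; [eapply s_seq; [apply s_push; exact Hi|apply s_push; exact Hi|apply le_n]| |lia].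
    now rewrite upd_upd, get_upd_same by lia. }
  destruct a; simpl; auto.
  eapply sexec_le; [apply s_push; exact Hi|lia].
Qed.

(** An empty stack reads as [Blank]: it stands for the untouched part of the simulated tape. *)
Definition readsym (i : nat) (k : sym -> tcom) : tcom :=
  popcase i (k Blank) (k Blank) (popcase i (k Blank) (k Zero) (k One)).

Lemma s_readsym_nil i k s n s' : i < nstacks -> get i s = [] ->
  sexec (k Blank) s n s' -> sexec (readsym i k) s (n + 2) s'.
Proof.
  intros Hi E R. eapply sexec_le; [eapply s_case_nil; eauto|lia].
Qed.

Lemma s_readsym_cons i k a l s n s' : length s = nstacks -> i < nstacks ->
  get i s = esyms (a :: l) -> sexec (k a) (upd i (esyms l) s) n s' ->
  sexec (readsym i k) s (n + 2) s'.
Proof.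
  intros Ls Hi E R. destruct a; simpl in E.
  - eapply sexec_le; [eapply s_case_cons; [exact Hi|exact E|exact R]|lia].
  - replace (n + 2) with (S (S n)) by lia. eapply s_case_cons; [exact Hi|exact E|].
    eapply s_case_cons; [exact Hi|apply get_upd_same; lia|]. now rewrite upd_upd.
  - replace (n + 2) with (S (S n)) by lia. eapply s_case_cons; [exact Hi|exact E|].
    eapply s_case_cons; [exact Hi|apply get_upd_same; lia|]. now rewrite upd_upd.
Qed.

(* Stack Q holds the state of the simulated machine in unary, 0 being the halting state. *)
Definition qcode (M : TM) (q : nat) : nat := if q =? tm_halt M then 0 else S q.

Definition act (M : TM) (q : nat) (a : sym) : tcom :=
  let '(q', a', d) := tm_delta M q a in
  pushn kQ (qcode M q') ;;
  match d with
  | Stay => writesym kW a'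
  | MoveR => writesym kL a'
  | MoveL => writesym kW a' ;; readsym kL (writesym kW)
  end.

(** Turns the unary state on stack Q into a position in the program: every pop advances [q], and the
    branch taken on the empty stack acts for the state counted so far. The successor in [qcode] has
    already been popped by the loop of [simulate]. *)
Fixpoint dispatch (M : TM) (fuel q : nat) : tcom :=
  match fuel with
  | 0 => TSkip
  | S fuel => popcase kQ (readsym kW (act M q)) TSkip (dispatch M fuel (S q))
  end.

Definition simulate (M : TM) : tcom := poploop kQ TSkip (dispatch M (tm_states M) 0).

(* Stacks W and L hold the simulated tape, the head being at the top of W. *)
Definition holds (c : config) (w l : list bool) : Prop :=
  l = esyms (c_left c) /\
  (w = esyms (c_head c :: c_right c) \/ w = [] /\ c_head c = Blank /\ c_right c = []).

Lemma s_act M c d a r s x cc t y f : tm_valid M -> c_state c < tm_states M ->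
  c_state c <> tm_halt M ->
  exists w' l', holds (step M c) w' l' /\
  sexec (act M (c_state c) (c_head c))
    (St d a r s x cc t (esyms (c_right c)) (esyms (c_left c)) [] y f) (tm_states M + 6)
    (St d a r s x cc t w' l' (repeat true (qcode M (c_state (step M c)))) y f).
Proof.
  intros (_ & _ & V) Hq Hh. unfold step. rewrite (proj2 (Nat.eqb_neq _ _) Hh). unfold act.
  specialize (V _ (c_head c) Hq). destruct (tm_delta M (c_state c) (c_head c)) as [[q' a'] m].
  simpl in V. assert (Q : qcode M q' <= tm_states M) by (unfold qcode; destruct (_ =? _); lia).
  assert (P : forall w l, sexec (pushn kQ (qcode M q')) (St d a r s x cc t w l [] y f) (qcode M q')
            (St d a r s x cc t w l (repeat true (qcode M q')) y f)).
  { intros w l. eapply s_eq; [apply s_pushn; [reflexivity|unfold nstacks; lia]| |apply le_n].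
    cbn [upd get nth]. now rewrite app_nil_r. }
  destruct m.
  - destruct (c_left c) as [|b lf] eqn:El.
    + exists (esyms (Blank :: a' :: c_right c)), []. split; [split; auto|].
      eapply s_seq; [apply P| |cbn [c_state]; apply Nat.add_le_mono; [exact Q|apply le_n]].
      eapply sexec_le; [eapply s_seq; [apply s_writesym; [reflexivity|unfold nstacks; lia]|
        cbn [upd get nth]; eapply s_readsym_nil; [unfold nstacks; lia|reflexivity|
        apply s_writesym; [reflexivity|unfold nstacks; lia]]|apply le_n]|lia].
    + exists (esyms (b :: a' :: c_right c)), (esyms lf). split; [split; auto|].
      eapply s_seq; [apply P| |cbn [c_state]; apply Nat.add_le_mono; [exact Q|apply le_n]].
      eapply sexec_le; [eapply s_seq; [apply s_writesym; [reflexivity|unfold nstacks; lia]|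
        cbn [upd get nth]; eapply (s_readsym_cons _ _ b lf); [reflexivity|unfold nstacks; lia|reflexivity|
        apply s_writesym; [reflexivity|unfold nstacks; lia]]|apply le_n]|lia].
  - exists (esyms (c_right c)), (esyms (a' :: c_left c)). split.
    (* Moving right off the stored part leaves W empty, the second alternative of [holds]. *)
    + destruct (c_right c); split; auto.
    + eapply s_seq; [apply P| |].
      * replace (c_state _) with q' by (destruct (c_right c); reflexivity).
        apply s_writesym; [reflexivity|unfold nstacks; lia].
      * lia.
  - exists (esyms (a' :: c_right c)), (esyms (c_left c)). split; [split; auto|].
    eapply s_seq; [apply P|apply s_writesym; [reflexivity|unfold nstacks; lia]|cbn [c_state]; lia].
Qed.

Lemma s_dispatch M fuel d a r s x cc t w l y f n s' : forall j q, j < fuel ->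
  sexec (readsym kW (act M (q + j))) (St d a r s x cc t w l [] y f) n s' ->
  sexec (dispatch M fuel q) (St d a r s x cc t w l (repeat true j) y f) (n + j + 1) s'.
Proof.
  induction fuel as [|fuel IH]; intros j q Hj E; [lia|]. simpl. destruct j as [|j].
  - rewrite Nat.add_0_r in E.
    eapply sexec_le; [eapply s_case_nil; [unfold nstacks; lia|reflexivity|exact E]|lia].
  - replace (q + S j) with (S q + j) in E by lia.
    eapply sexec_le; [eapply s_case_cons; [unfold nstacks; lia|reflexivity|]|].
    + cbn [upd]. apply IH; [lia|exact E].
    + lia.
Qed.

Lemma s_simulate M d a r s x cc t y f : tm_valid M -> forall k c w l,
  c_state c < tm_states M -> c_state (run M k c) = tm_halt M -> holds c w l ->
  exists w' l', holds (run M k c) w' l' /\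
  sexec (simulate M)
    (St d a r s x cc t w l (repeat true (qcode M (c_state c))) y f)
    (k * (2 * tm_states M + 10) + 1)
    (St d a r s x cc t w' l' [] y f).
Proof.
  (* The given [k] may lie beyond the first halting time; from then on [step] is frozen and the
     simulation has ended. *)
  intros V. assert (Halted : forall k c, c_state c = tm_halt M -> run M k c = c).
  { induction k; intros c E; simpl; auto. unfold step. rewrite (proj2 (Nat.eqb_eq _ _) E); auto. }
  assert (Done : forall c k w l, c_state c = tm_halt M -> holds c w l ->
    exists w' l', holds (run M k c) w' l' /\
    sexec (simulate M)
      (St d a r s x cc t w l (repeat true (qcode M (c_state c))) y f)
      (k * (2 * tm_states M + 10) + 1)
      (St d a r s x cc t w' l' [] y f)).
  { intros c k w l E Hc. exists w, l. rewrite Halted by exact E. split; [exact Hc|].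
    unfold qcode. rewrite (proj2 (Nat.eqb_eq _ _) E). simpl.
    eapply sexec_le; [loop_nil|lia]. }
  induction k as [|k IH]; intros c w l Hq Hh Hc.
  - apply Done; auto.
  - destruct (Nat.eq_dec (c_state c) (tm_halt M)) as [E|E]; [now apply Done|].
    destruct (s_act M c d a r s x cc t y f V Hq E) as (w1 & l1 & Hc1 & A).
    destruct (IH (step M c) w1 l1) as (w2 & l2 & Hc2 & A2); auto.
    { unfold step. rewrite (proj2 (Nat.eqb_neq _ _) E).
      destruct V as (_ & _ & V). specialize (V _ (c_head c) Hq).
      destruct (tm_delta M (c_state c) (c_head c)) as [[q' a'] m]. simpl in V.
      destruct m; [destruct (c_left c)|destruct (c_right c)|]; exact V. }
    exists w2, l2. split; [exact Hc2|].
    unfold qcode at 1. rewrite (proj2 (Nat.eqb_neq _ _) E). cbn [repeat].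
    eapply s_loop_cons; [unfold nstacks; lia|reflexivity| |exact A2|].
    + cbn [upd]. eapply s_dispatch; [exact Hq|]. destruct Hc as [-> [->|(-> & E1 & E2)]].
      * eapply s_readsym_cons; [reflexivity|unfold nstacks; lia|reflexivity|exact A].
      * eapply s_readsym_nil; [unfold nstacks; lia|reflexivity|].
        rewrite E1, E2 in A. exact A.
    + lia.
Qed.

Definition read_output : tcom :=
  poploop kW (clear kW) (popcase kW TSkip (push kY false) (push kY true)) ;; clear kL.

Lemma read_output_loop m : forall d a r s x c t l q y f,
  sexec (poploop kW (clear kW) (popcase kW TSkip (push kY false) (push kY true)))
    (St d a r s x c t (esyms m) l q y f) (5 * length m + 5)
    (St d a r s x c t [] l q (rev_append (read_word m) y) f).
Proof.
  induction m as [|b m IH]; intros d a r s x c t l q y f; [eapply sexec_le; [loop_nil|lia]|].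
  assert (length (esyms m) <= 2 * length m)
    by (clear; induction m as [|[] m IH]; simpl in *; lia).
  destruct b; cbn [esyms flat_map esym app]; fold (esyms m); cbn [read_word].
  - eapply s_loop_cons; [unfold nstacks; lia|reflexivity|sx|cbn [upd get nth]; loop_nil|].
    cbn [upd get nth]. simpl length; lia.
  - loop_cons 2 using (apply (IH d a r s x c t l q (false :: y))); [sxl|simpl; lia].
  - loop_cons 2 using (apply (IH d a r s x c t l q (true :: y))); [sxl|simpl; lia].
Qed.

Definition run_machine (M : TM) : tcom :=
  feed ;; pushn kQ (qcode M (tm_start M)) ;; simulate M ;; read_output.

Lemma step_growth M c :
  length (c_left (step M c)) <= S (length (c_left c)) /\
  length (c_right (step M c)) <= S (length (c_right c)).
Proof.
  unfold step. destruct (_ =? _); [lia|].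
  destruct (tm_delta M (c_state c) (c_head c)) as [[q' a'] []];
    destruct (c_left c), (c_right c); simpl; lia.
Qed.

(** Bounds the cost of reading off and clearing the simulated tape at the end of a run. *)
Lemma run_growth M k : forall c,
  length (c_left (run M k c)) <= k + length (c_left c) /\
  length (c_right (run M k c)) <= k + length (c_right c).
Proof.
  induction k as [|k IH]; intros c; simpl; [lia|].
  specialize (IH (step M c)). pose proof (step_growth M c). lia.
Qed.

Lemma esyms_length m : length (esyms m) <= 2 * length m.
Proof. induction m as [|[] m IH]; simpl in *; lia. Qed.

Lemma s_run_machine M d a r s xx cc w tm y f : tm_valid M ->
  runs_within M w tm y ->
  sexec (run_machine M)
    (St d a r s xx cc (rev_append w []) [] [] [] [] f)
    (10 * length w + tm * (2 * tm_states M + 17) + tm_states M + 15)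
    (St d a r s xx cc [] [] [] [] (rev_append y []) f).
Proof.
  intros V (k & Hk & Hh & Ho).
  assert (H0 : holds (init M w) (esyms (map sym_of_bool w)) []).
  { unfold init. destruct (map sym_of_bool w); split; auto. }
  assert (Q0 : c_state (init M w) = tm_start M)
    by (unfold init; destruct (map sym_of_bool w); reflexivity).
  destruct (s_simulate M d a r s xx cc [] [] f V k (init M w) (esyms (map sym_of_bool w)) []) as (w' & l' & (-> & H2) & E);
    [rewrite Q0; apply V|exact Hh|exact H0|].
  rewrite Q0 in E.
  destruct (run_growth M k (init M w)) as [G1 G2].
  assert (I1 : length (c_left (init M w)) = 0 /\ length (c_right (init M w)) <= length w).
  { rewrite <- (length_map sym_of_bool w).
    unfold init; destruct (map sym_of_bool w); simpl; lia. }
  assert (exists m, w' = esyms m /\ read_word m = y /\ length m <= 1 + (k + length w))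
    as (m & -> & <- & Lm).
  { rewrite <- Ho. unfold output. destruct H2 as [->|(-> & -> & ->)].
    - eexists; split; [reflexivity|split; [reflexivity|simpl; lia]].
    - exists []; split; [reflexivity|split; [reflexivity|simpl; lia]]. }
  assert (Q : qcode M (tm_start M) <= tm_states M)
    by (destruct V as [V _]; unfold qcode; destruct (_ =? _); lia).
  pose proof (esyms_length (c_left (run M k (init M w)))) as Ll.
  assert (LX : k * (2 * tm_states M + 17) <= tm * (2 * tm_states M + 17))
    by (apply Nat.mul_le_mono_r; exact Hk).
  eapply s_seq; [apply (feed_loop _ d a r s xx cc [])| |].
  - rewrite rev_append_twice.
    eapply s_seq; [eapply s_eq; [apply s_pushn; [reflexivity|unfold nstacks; lia]| |apply le_n]| |apply le_n].
    + cbn [upd get nth]. rewrite app_nil_r. reflexivity.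
    + eapply s_seq; [exact E| |apply le_n].
      eapply s_seq; [apply read_output_loop|sx|apply le_n].
  - cbn [get nth]. rewrite rev_append_length. simpl length. lia.
Qed.

(** * From the machine's answer to a vertex set *)

Definition ones (r : list bool) : nat := count_occ bool_dec r true.

Lemma ones_rev_append r s : ones (rev_append r s) = ones r + ones s.
Proof.
  unfold ones. now rewrite rev_append_rev, count_occ_app, count_occ_rev.
Qed.

(** [y] has one bit for each vertex selected by [r]; the result is the mask of the same set among
    all vertices. *)
Fixpoint fill (r y : list bool) : list bool :=
  match r with
  | [] => []
  | true :: r => hd false y :: fill r (tl y)
  | false :: r => false :: fill r y
  end.

Definition expand : tcom :=
  mv kR kX ;;
  poploop kX (push kR false ;; push kS false)
    (push kR true ;; popcase kY TSkip (push kS false) (push kS true)).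

(** Mask and answer are both consumed from their last bit, X and Y holding them reversed. Hence the
    part of S already built is [fill] applied to matching suffixes. *)
Lemma expand_loop m : forall d a r c t w l q y z f, length y = ones m ->
  sexec
    (poploop kX (push kR false ;; push kS false)
      (push kR true ;; popcase kY TSkip (push kS false) (push kS true)))
    (St d a r (fill r z) m c t w l q y f) (4 * length m + 1)
    (St d a (rev_append m r) (fill (rev_append m r) (rev_append y z)) [] c t w l q [] f).
Proof.
  induction m as [|b m IH]; intros d a r c t w l q y z f Ly.
  - destruct y; [|discriminate]. loop_nil.
  - destruct b.
    + destruct y as [|b y]; [discriminate|].
      loop_cons 3 using (apply (IH d a (true :: r) c t w l q y (b :: z)); simpl in Ly; auto).
      * destruct b; sxl.
      * simpl; lia.
    + loop_cons 2 using (apply (IH d a (false :: r) c t w l q y z); auto).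
      * sxl.
      * simpl; lia.
Qed.

Lemma s_expand d a r c t w l q y f : length y = ones r ->
  sexec expand (St d a r [] [] c t w l q (rev_append y []) f) (6 * length r + 2)
    (St d a r (fill r y) [] c t w l q [] f).
Proof.
  intros Ly. eapply s_eq; [unfold expand; eapply s_seq;
    [sx|cbn [upd get nth]; apply (expand_loop _ d a []);
        rewrite rev_append_length, ones_rev_append, Ly; unfold ones; simpl; lia|apply le_n]| |];
    cbn [upd get nth].
  - now rewrite !rev_append_twice.
  - rewrite rev_append_length; simpl; lia.
Qed.

Lemma fill_length r : forall y, length (fill r y) = length r.
Proof. induction r as [|[] r IH]; intros y; simpl; auto. Qed.

Definition submatrix (m : list bool) (rows : list (list bool)) : list bool :=
  concat (map (sel m) (sel m rows)).

Definition square (n : nat) (rows : list (list bool)) : Prop :=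
  length rows = n /\ Forall (fun row => length row = n) rows.

(** The given algorithm does not tell which kind of set it returns. A one in the submatrix of the
    set is an edge and means a clique; a single vertex thus counts as independent. The first one
    found empties T and so ends the loop. *)
Definition check : tcom :=
  copy_set ;; extract ;; poploop kT TSkip (clear kT ;; push kC true).

Lemma check_loop m : forall d a r s x w l q y f,
  sexec (poploop kT TSkip (clear kT ;; push kC true))
    (St d a r s x [] m w l q y f) (length m + 4)
    (St d a r s x (if existsb (fun b => b) m then [true] else []) [] w l q y f).
Proof.
  induction m as [|[] m IH]; intros d a r s x w l q y f; [eapply sexec_le; [loop_nil|lia]| |].
  - eapply s_loop_cons; [unfold nstacks; lia|reflexivity|sx|cbn [upd get nth]; loop_nil|].
    cbn [get nth]; simpl; lia.
  - loop_cons 0 using (apply IH); [apply s_skip|simpl; lia].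
Qed.

Lemma concat_square n rows : square n rows -> length (concat rows) = n * n.
Proof.
  intros [L F]. rewrite <- L at 1. clear L.
  induction F as [|row rows Lr F IH]; simpl; auto.
  now rewrite length_app, Lr, IH.
Qed.

Lemma sel_length {A : Type} m : forall l : list A, length (sel m l) <= length l.
Proof. induction m as [|[] m IH]; intros [|a l]; simpl; try lia; specialize (IH l); lia. Qed.

Lemma submatrix_length n m rows : square n rows -> length (submatrix m rows) <= n * n.
Proof.
  intros [L F]. pose proof (sel_length m rows) as Ls. rewrite L in Ls.
  assert (F' : Forall (fun row => length row = n) (sel m rows)).
  { clear L Ls. revert m. induction F as [|row rows Lr F IH]; intros [|[] m]; simpl; auto. }
  etransitivity; [|apply Nat.mul_le_mono_r, Ls].
  unfold submatrix. generalize dependent (sel m rows). intros rs _ F'.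
  induction F' as [|row rs Lr F' IH]; simpl; auto.
  rewrite length_app. pose proof (sel_length m row). lia.
Qed.

Lemma s_extract_square n m r t w l q y f rows : square n rows -> length m = n ->
  sexec extract
    (St [] (concat rows) r m [] m t w l q y f) (9 * n * n + 3 * n + 2)
    (St [] (concat rows) r m [] [] (rev_append (submatrix m rows) t) w l q y f).
Proof.
  intros Sq Lm. eapply sexec_le; [apply s_extract|].
  - destruct Sq; congruence.
  - rewrite Lm; apply Sq.
  - rewrite (concat_square n) by exact Sq. nia.
Qed.

Lemma s_check n r s w l q y f rows : square n rows -> length s = n ->
  sexec check
    (St [] (concat rows) r s [] [] [] w l q y f) (10 * n * n + 8 * n + 8)
    (St [] (concat rows) r s [] (if existsb (fun b => b) (submatrix s rows) then [true] else [])
      [] w l q y f).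
Proof.
  intros Sq Ls. pose proof (submatrix_length n s rows Sq).
  eapply s_eq; [unfold check; eapply s_seq;
    [apply s_copy_set|eapply s_seq; [apply (s_extract_square n); auto|apply check_loop|apply le_n]|apply le_n]| |].
  - replace (existsb (fun b => b) (rev_append (submatrix s rows) [])) with (existsb (fun b => b) (submatrix s rows)); auto.
    rewrite rev_append_rev, app_nil_r. apply eq_true_iff_eq.
    rewrite !existsb_exists. split; intros (b & Hb & Eb); exists b; (split; [|exact Eb]);
      rewrite <- in_rev in *; exact Hb.
  - rewrite rev_append_length; simpl; lia.
Qed.

(** * Deleting a clique, and the whole program *)

Fixpoint minus (r s : list bool) : list bool :=
  match r, s with
  | a :: r, b :: s => (a && negb b) :: minus r s
  | _, _ => []
  end.

(* The program needs a nonempty vertex set to go on with. *)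
Definition reset (r : list bool) : list bool :=
  if ones r =? 0 then match r with [] => [] | _ :: r => true :: r end else r.

(** C receives one bit per remaining vertex, so that its emptiness tells whether R must be reset.
    The bit on F asks for another round. *)
Definition update : tcom :=
  poploop kR (popcase kS TSkip TSkip TSkip ;; push kX false)
    (popcase kS TSkip (push kX true) (push kX false)) ;;
  poploop kX (push kR false) (push kR true ;; push kC true) ;;
  popcase kC (popcase kR TSkip (push kR true) (push kR true)) (clear kC) (clear kC) ;;
  push kF true.

Lemma update_loop1 r : forall d a s x c t w l q y f, length s = length r ->
  sexec
    (poploop kR (popcase kS TSkip TSkip TSkip ;; push kX false)
      (popcase kS TSkip (push kX true) (push kX false)))
    (St d a r s x c t w l q y f) (3 * length r + 1)
    (St d a [] [] (rev_append (minus r s) x) c t w l q y f).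
Proof.
  induction r as [|b r IH]; intros d a [|b' s] x c t w l q y f Ls; try discriminate.
  - loop_nil.
  - loop_cons 2 using (apply (IH d a s ((b && negb b') :: x)); auto).
    + destruct b, b'; sxl.
    + simpl; lia.
Qed.

Lemma update_loop2 m : forall d a r s c t w l q y f,
  sexec (poploop kX (push kR false) (push kR true ;; push kC true))
    (St d a r s m (repeat true c) t w l q y f) (3 * length m + 1)
    (St d a (rev_append m r) s [] (repeat true (ones m + c)) t w l q y f).
Proof.
  induction m as [|[] m IH]; intros d a r s c t w l q y f; [loop_nil| |].
  - replace (ones (true :: m) + c) with (ones m + S c) by (unfold ones; simpl; lia).
    loop_cons 2 using (apply (IH d a (true :: r) s (S c))); [sxl|simpl; lia].
  - loop_cons 1 using (apply (IH d a (false :: r))); [sxl|simpl; lia].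
Qed.

Lemma minus_length r : forall s, length s = length r -> length (minus r s) = length r.
Proof. induction r; intros [|b s] L; try discriminate; simpl in *; auto. Qed.

Lemma ones_le r : ones r <= length r.
Proof. apply count_occ_bound. Qed.

Lemma s_update d a r s t w l q y f : length s = length r ->
  sexec update (St d a r s [] [] t w l q y f) (7 * length r + 7)
    (St d a (reset (minus r s)) [] [] [] t w l q y (true :: f)).
Proof.
  intros Ls. pose proof (minus_length r s Ls) as Lm. pose proof (ones_le (minus r s)) as Lo.
  eapply s_seq; [apply update_loop1, Ls| |].
  - eapply s_seq; [apply (update_loop2 _ d a [] [] 0)| |].
    + rewrite ones_rev_append, rev_append_twice.
      replace (ones (minus r s) + ones [] + 0) with (ones (minus r s)) by (unfold ones; simpl; lia).
      eapply s_seq with (n1 := ones (minus r s) + 3)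
        (s1 := St d a (reset (minus r s)) [] [] [] t w l q y f); [|sx|apply le_n].
      unfold reset. destruct (ones (minus r s)) as [|k]; simpl repeat; simpl Nat.eqb; cbv iota.
      * destruct (minus r s) as [|[] m]; sxl.
      * eapply sexec_le; [sx|]. cbn [get nth]. rewrite repeat_length. lia.
    + apply le_n.
  - rewrite rev_append_length, Lm. simpl. lia.
Qed.

Definition body (M : TM) : tcom :=
  copy_mask ;; extract ;; clear kS ;; run_machine M ;; expand ;; check ;;
  popcase kC (mv kS kD) update update.

Lemma s_body M n rows r tm y :
  tm_valid M -> square n rows -> length r = n ->
  runs_within M (submatrix r rows) tm y -> length y = ones r ->
  sexec (body M)
    (St [] (concat rows) r [] [] [] [] [] [] [] [] [])
    (29 * n * n + 33 * n + 60 + tm * (2 * tm_states M + 17) + tm_states M)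
    (if existsb (fun b => b) (submatrix (fill r y) rows)
     then St [] (concat rows) (reset (minus r (fill r y))) [] [] [] [] [] [] [] [] [true]
     else St (rev_append (fill r y) []) (concat rows) r [] [] [] [] [] [] [] [] []).
Proof.
  intros V Sq Lr Rw Ly.
  pose proof (submatrix_length n r rows Sq). pose proof (fill_length r y) as Lf.
  eapply s_seq; [apply s_copy_mask| |].
  - eapply s_seq; [apply (s_extract_square n); auto| |apply le_n].
    eapply s_seq; [sx| |apply le_n]. cbn [upd get nth].
    eapply s_seq; [apply s_run_machine; eauto| |apply le_n].
    eapply s_seq; [apply s_expand, Ly| |apply le_n].
    (* A common bound for both branches: testing C costs 1, then [update] costs [7 * n + 7], and
       moving S to D only [2 * n + 1]. *)
    eapply s_seq with (n2 := 7 * n + 8); [apply (s_check n); auto; congruence| |apply le_n].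
    destruct (existsb (fun b => b) (submatrix (fill r y) rows)).
    + eapply sexec_le; [eapply s_case_cons; [unfold nstacks; lia|reflexivity|]|].
      * cbn [upd]. apply s_update. exact Lf.
      * lia.
    + eapply sexec_le; [eapply s_case_nil; [unfold nstacks; lia|reflexivity|sx]|].
      cbn [get nth]. lia.
  - cbn [get nth]. lia.
Qed.

Definition program (M : TM) : tcom :=
  measure ;; push kF true ;; poploop kF TSkip (body M).

Lemma s_program M n rows k s :
  square n rows ->
  sexec (poploop kF TSkip (body M))
    (St [] (concat rows) (repeat true n) [] [] [] [] [] [] [] [] [true]) k s ->
  sexec (program M) (start_state (concat rows)) (12 * n * n + 8 * n + 2 + k) s.
Proof.
  intros Sq E. eapply s_seq.
  - apply (s_measure [] [] [] [] [] [] [] [] n 0).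
    rewrite length_rev, (concat_square n); auto.
  - rewrite <- (app_nil_r (rev (concat rows))), <- rev_append_rev, rev_append_twice.
    eapply s_seq; [sx|exact E|apply le_n].
  - lia.
Qed.

(** * The approximation ratio *)

Open Scope R_scope.

Lemma Rpower_pos x a : 0 < Rpower x a.
Proof. apply exp_pos. Qed.

Lemma exp_mono x y : x <= y -> exp x <= exp y.
Proof. intros [H|H]; [left; now apply exp_increasing|right; now rewrite H]. Qed.

Lemma Rpower_bernoulli y b : 0 < y -> 0 <= b <= 1 -> Rpower y b <= 1 + b * (y - 1).
Proof.
  intros Hy Hb. unfold Rpower. set (L := ln y). set (e := exp (b * L)).
  assert (E : 0 < e) by apply exp_pos.
  assert (Y : y = e * exp ((1 - b) * L)).
  { unfold e, L. rewrite <- exp_plus. replace (b * ln y + (1 - b) * ln y) with (ln y) by ring.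
    now rewrite exp_ln. }
  assert (O : 1 = e * exp (- (b * L)))
    by (unfold e; rewrite <- exp_plus, Rplus_opp_r, exp_0; reflexivity).
  (* weighted AM-GM: y and 1 are e times exponentials, bounded below by 1 + x <= exp x *)
  assert (A1 : e * (1 + (1 - b) * L) <= y)
    by (rewrite Y; apply Rmult_le_compat_l; [lra|apply exp_ineq1_le]).
  assert (A2 : e * (1 + - (b * L)) <= 1)
    by (apply Rle_trans with (e * exp (- (b * L))); [|lra];
        apply Rmult_le_compat_l; [lra|apply exp_ineq1_le]).
  apply (Rmult_le_compat_l b) in A1; [|lra].
  apply (Rmult_le_compat_l (1 - b)) in A2; [|lra].
  lra.
Qed.

(** Bernoulli's inequality rescaled by [x]: the concave power lies below its tangent at [x].
    Concavity enters the estimates below in this form. *)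
Lemma Rpower_tangent x y b : 0 < x -> 0 < y -> 0 <= b <= 1 ->
  Rpower y b <= Rpower x b * (1 + b * (y / x - 1)).
Proof.
  intros Hx Hy Hb.
  assert (Hq : 0 < y / x) by (apply Rdiv_lt_0_compat; auto).
  replace y with (x * (y / x)) at 1 by (field; lra).
  rewrite <- Rpower_mult_distr by auto.
  apply Rmult_le_compat_l; [left; apply Rpower_pos|].
  now apply Rpower_bernoulli.
Qed.

(** This bound and the next one serve to prove [e * (ln 2)^2 >= 1]: [2.5 * 0.636^2] is about 1.011.
    The value 2.5 comes from [1.1^10], about 2.59. *)
Lemma exp_1_lower : 2.5 <= exp 1.
Proof.
  replace (exp 1) with (exp (1/10) ^ 10).
  - apply Rle_trans with ((1 + 1/10) ^ 10); [lra|].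
    apply pow_incr; split; [lra|apply exp_ineq1_le].
  - rewrite <- Rpower_pow by apply exp_pos. unfold Rpower. rewrite ln_exp.
    f_equal. simpl. lra.
Qed.

(** [0.841^4] is slightly above [1/2], and [ln 0.841 <= 0.841 - 1], so that [ln 2 >= 4 * 0.159]. *)
Lemma ln_2_lower : 0.636 <= ln 2.
Proof.
  assert (E : ln (/ 2) <= ln (0.841 ^ 4)).
  { destruct (Req_dec (/2) (0.841 ^ 4)) as [->|N]; [lra|].
    left; apply ln_increasing; lra. }
  rewrite ln_Rinv in E by lra. rewrite ln_pow in E by lra.
  pose proof (exp_ineq1_le (ln 0.841)) as X. rewrite exp_ln in X by lra.
  simpl INR in E. lra.
Qed.

(** Since [K^d = 2], the right side is [(K / 2) * 2^d], and the claim becomes [K * (2^d - 1) >= 1].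
    Now [2^d - 1 >= d * ln 2], and [e^u >= e * u] at [u = ln 2 / d] gives [K >= e * ln 2 / d]; the
    product of the two bounds is [e * (ln 2)^2]. *)
Lemma half_le_Rpower_end d (K := Rpower 2 (1 / d)) :
  0 < d -> (K + 1) / 2 <= Rpower K (1 - d + d ^ 2).
Proof.
  intros Hd. pose proof ln_2_lower as L. pose proof exp_1_lower as E.
  assert (P : Rpower K (1 - d + d ^ 2) = K * / 2 * Rpower 2 d).
  { unfold K. rewrite Rpower_mult.
    replace (1 / d * (1 - d + d ^ 2)) with (1 / d + Ropp 1 + d) by (field; lra).
    rewrite !Rpower_plus, Rpower_Ropp, Rpower_1 by lra. reflexivity. }
  assert (P2 : 1 + d * ln 2 <= Rpower 2 d) by apply exp_ineq1_le.
  assert (PK : exp 1 * (ln 2 / d) <= K).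
  { unfold K, Rpower. replace (1 / d * ln 2) with (1 + (ln 2 / d - 1)) by (field; lra).
    rewrite exp_plus. apply Rmult_le_compat_l; [left; apply exp_pos|].
    pose proof (exp_ineq1_le (ln 2 / d - 1)). lra. }
  assert (K0 : 0 < K) by apply Rpower_pos.
  assert (1 <= K * (d * ln 2)).
  { apply Rle_trans with (exp 1 * (ln 2 / d) * (d * ln 2)).
    - replace (exp 1 * (ln 2 / d) * (d * ln 2)) with (exp 1 * (ln 2 * ln 2)) by (field; lra). nra.
    - apply Rmult_le_compat_r; [nra|exact PK]. }
  rewrite P. nra.
Qed.

Lemma half_le_Rpower d x : 0 < d -> d <= 1 / 2 -> 1 <= x -> Rpower x d <= 2 ->
  (x + 1) / 2 <= Rpower x (1 - d + d ^ 2).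
Proof.
  intros Hd Hd2 Hx H2. set (K := Rpower 2 (1 / d)). set (b := 1 - d + d ^ 2).
  assert (Hb : 0 <= b <= 1) by (unfold b; nra).
  assert (K1 : 1 < K).
  { apply Rle_lt_trans with (Rpower 2 0); [rewrite Rpower_O; lra|].
    apply Rpower_lt; [lra|apply Rdiv_lt_0_compat; lra]. }
  assert (xK : x <= K).
  { replace x with (Rpower (Rpower x d) (1 / d)).
    - apply Rle_Rpower_l; [apply Rlt_le, Rdiv_lt_0_compat; lra|].
      split; [apply Rpower_pos|exact H2].
    - rewrite Rpower_mult. replace (d * (1 / d)) with 1 by (field; lra). apply Rpower_1; lra. }
  pose proof (half_le_Rpower_end d Hd) as EK. cbv zeta in EK; fold K b in EK.
  (* concavity between the end points 1 and K *)
  pose proof (Rpower_tangent x K b ltac:(lra) ltac:(lra) Hb) as TK.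
  pose proof (Rpower_tangent x 1 b ltac:(lra) ltac:(lra) Hb) as T1.
  replace (Rpower 1 b) with 1 in T1 by (unfold Rpower; rewrite ln_1, Rmult_0_r, exp_0; reflexivity).
  apply (Rmult_le_compat_l (x - 1)) in TK; [|lra].
  apply (Rmult_le_compat_l (K - x)) in T1; [|lra].
  apply (Rmult_le_compat_l (x - 1)) in EK; [|lra].
  (* With weights [x - 1] and [K - x] the slope terms of the two tangent bounds at [x] cancel. *)
  assert (F : (x - 1) * (Rpower x b * (1 + b * (K / x - 1))) +
              (K - x) * (Rpower x b * (1 + b * (1 / x - 1))) = (K - 1) * Rpower x b)
    by (field; lra).
  apply Rmult_le_reg_l with (K - 1); [lra|].
  lra.
Qed.

(** By the tangent at [x] the decrease is at least [b * c * x^(b-1)], where [b - 1 = - d * (1 - d)].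
    As [b * e^d >= 1], it suffices that [c * x^(- d * (1 - d)) >= e^d]. *)
Lemma Rpower_decrease d x c : 0 < d -> d <= 1 / 2 -> 1 <= x ->
  3 <= c -> Rpower x d <= c -> c < x ->
  Rpower (x - c) (1 - d + d ^ 2) + 1 <= Rpower x (1 - d + d ^ 2).
Proof.
  intros Hd Hd2 Hx H3 Hc Hcx. set (b := 1 - d + d ^ 2).
  assert (Hb : 0 <= b <= 1) by (unfold b; nra).
  pose proof (Rpower_tangent x (x - c) b ltac:(lra) ltac:(lra) Hb) as T.
  replace (Rpower x b * (1 + b * ((x - c) / x - 1)))
    with (Rpower x b - b * c * (Rpower x b / x)) in T by (field; lra).
  replace (Rpower x b / x) with (Rpower x (- (d * (1 - d)))) in T.
  2: { replace (- (d * (1 - d))) with (b + Ropp 1) by (unfold b; ring).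
       rewrite Rpower_plus, Rpower_Ropp, Rpower_1 by lra. reflexivity. }
  (* [(1 - d + d^2) * (1 + d) = 1 + d^3]. *)
  assert (D : 1 <= b * exp d).
  { pose proof (exp_ineq1_le d). apply Rle_trans with (b * (1 + d)); [unfold b; nra|].
    apply Rmult_le_compat_l; lra. }
  cut (1 <= b * (c * Rpower x (- (d * (1 - d))))); [lra|].
  apply Rle_trans with (1 := D). apply Rmult_le_compat_l; [lra|].
  (* The threshold is [x^d = e]. Below it, [c >= 3 >= e] and [x^(- d * (1 - d)) >= e^(d - 1)]; above
     it, [c >= x^d] leaves [x^(d^2) >= e^d]. *)
  destruct (Rle_or_lt (d * ln x) 1) as [C|C].
  - apply Rle_trans with (3 * Rpower x (- (d * (1 - d)))).
    + apply Rle_trans with (exp 1 * exp (d - 1)).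
      * rewrite <- exp_plus. right; f_equal; lra.
      * apply Rmult_le_compat; [left; apply exp_pos|left; apply exp_pos|apply exp_le_3|].
        unfold Rpower. apply exp_mono.
        assert (d * ln x * (1 - d) <= 1 * (1 - d)) by (apply Rmult_le_compat_r; lra). lra.
    + apply Rmult_le_compat_r; [left; apply Rpower_pos|exact H3].
  - apply Rle_trans with (Rpower x d * Rpower x (- (d * (1 - d)))).
    + rewrite <- Rpower_plus. unfold Rpower. apply exp_mono.
      replace ((d + - (d * (1 - d))) * ln x) with (d * (d * ln x)) by ring. nra.
    + apply Rmult_le_compat_r; [left; apply Rpower_pos|exact Hc].
Qed.

(* The first conjunct gives the second one on the range k^d <= 2. *)
Definition good (d : R) (m s k : nat) : Prop :=
  INR m <= INR s * ((INR k + 1) / 2) /\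
  INR m <= INR s * Rpower (INR k) (1 - d + d ^ 2).

Lemma Rpower_ge_1 x a : 1 <= x -> 0 <= a -> 1 <= Rpower x a.
Proof.
  intros Hx Ha. rewrite <- (Rpower_O x) by lra. now apply Rle_Rpower.
Qed.

Lemma good_le d m m' s k : good d m s k -> (m' <= m)%nat -> good d m' s k.
Proof.
  intros [H1 H2] L. apply le_INR in L. split; lra.
Qed.

Lemma good_from_half d m s k : 0 < d -> d <= 1 / 2 -> (1 <= k)%nat -> Rpower (INR k) d <= 2 ->
  INR m <= INR s * ((INR k + 1) / 2) -> good d m s k.
Proof.
  intros Hd Hd2 Hk H2 H. split; auto. apply Rle_trans with (1 := H).
  apply Rmult_le_compat_l; [apply pos_INR|]. apply half_le_Rpower; auto.
  apply (le_INR 1); auto.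
Qed.

Lemma good_one d s k : 0 < d -> d <= 1 / 2 -> (1 <= s)%nat -> (1 <= k)%nat -> good d 1 s k.
Proof.
  intros Hd Hd2 Hs Hk. apply le_INR in Hs, Hk. simpl INR in *.
  pose proof (Rpower_ge_1 (INR k) (1 - d + d ^ 2) Hk ltac:(nra)).
  split; simpl INR; nra.
Qed.

(** For [k >= 2], [s >= k^d > 1] forces [s >= 2] by integrality, which yields the linear bound. The
    other one is [k <= k^d * k^b], since [d + b = 1 + d^2]. *)
Lemma good_base d m s k : 0 < d -> d <= 1 / 2 -> (1 <= k)%nat -> (1 <= s)%nat -> (m <= k)%nat ->
  Rpower (INR k) d <= INR s -> good d m s k.
Proof.
  intros Hd Hd2 Hk Hs Hm H. apply le_INR in Hm. pose proof (le_INR _ _ Hk) as Hk'. simpl INR in Hk'.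
  destruct (Nat.eq_dec k 1) as [->|Nk].
  - apply good_le with 1%nat; [apply good_one; auto|]. apply INR_le; exact Hm.
  - assert (Hk2 : 2 <= INR k) by (apply (le_INR 2); lia).
    assert (Hs2 : 2 <= INR s).
    { apply (le_INR 2). apply INR_lt. simpl INR.
      apply Rlt_le_trans with (2 := H). rewrite <- (Rpower_O (INR k)) by lra.
      apply Rpower_lt; lra. }
    split; [nra|].
    apply Rle_trans with (Rpower (INR k) d * Rpower (INR k) (1 - d + d ^ 2)).
    + rewrite <- Rpower_plus. apply Rle_trans with (Rpower (INR k) 1).
      * rewrite Rpower_1; lra.
      * apply Rle_Rpower; nra.
    + apply Rmult_le_compat_r; [left; apply Rpower_pos|exact H].
Qed.

(** The extra vertex is the one that may lie in the deleted clique. The linear bound drops by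
    [s * c / 2 >= 1], which pays for it. *)
Lemma good_step d m s k c : 0 < d -> d <= 1 / 2 -> (1 <= s)%nat -> (2 <= c)%nat -> (c < k)%nat ->
  Rpower (INR k) d <= INR c -> good d m s (k - c) -> good d (S m) s k.
Proof.
  intros Hd Hd2 Hs Hc Hck H [H1 H2]. rewrite minus_INR in H1, H2 by lia.
  apply lt_INR in Hck. apply le_INR in Hs. pose proof (le_INR _ _ Hc) as Hc'. simpl INR in *.
  assert (A : INR (S m) <= INR s * ((INR k + 1) / 2)) by (rewrite S_INR; nra).
  destruct (Rle_or_lt (Rpower (INR k) d) 2) as [K|K].
  - apply good_from_half; auto. apply INR_le. simpl; lra.
  - split; [exact A|]. rewrite S_INR.
    (* Integrality: [c >= k^d > 2]. The value 3 is what lifts [c] above [e]. *)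
    assert (3 <= INR c).
    { change 3 with (IZR 3). replace (IZR 3) with (INR 3) by (simpl; lra). apply le_INR.
      apply INR_lt. simpl INR. lra. }
    pose proof (Rpower_decrease d (INR k) (INR c) Hd Hd2 ltac:(lra) ltac:(lra) H Hck).
    apply (Rmult_le_compat_l (INR s)) in H3; [lra|lra].
Qed.

(** * Graphs and vertex masks *)

Open Scope nat_scope.

Lemma sel_map {A B : Type} (g : A -> B) m : forall l, sel m (map g l) = map g (sel m l).
Proof. induction m as [|[] m IH]; intros [|a l]; simpl; auto; f_equal; auto. Qed.

Lemma sel_incl {A : Type} m : forall l : list A, incl (sel m l) l.
Proof.
  induction m as [|[] m IH]; intros [|a l] v; simpl; try tauto; intros H.
  - destruct H as [H|H]; [now left|right; now apply IH].
  - right; now apply IH.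
Qed.

Lemma sel_NoDup {A : Type} m : forall l : list A, NoDup l -> NoDup (sel m l).
Proof.
  induction m as [|[] m IH]; intros [|a l] N; simpl; try constructor; inversion N; subst; auto.
  intros H; apply sel_incl in H; auto.
Qed.

Lemma sel_ones {A : Type} m : forall l : list A, length l = length m -> length (sel m l) = ones m.
Proof.
  unfold ones. induction m as [|[] m IH]; intros [|a l] L; simpl in *; try discriminate; auto.
Qed.

Lemma sel_fill {A : Type} r : forall y (l : list A), length l = length r -> length y = ones r ->
  sel (fill r y) l = sel y (sel r l).
Proof.
  induction r as [|[] r IH]; intros y [|a l] Ll Ly; simpl in Ll; try discriminate; auto.
  - now destruct y.
  - destruct y as [|[] y]; [discriminate| |]; simpl; [f_equal|]; apply IH; auto.
  - simpl. apply IH; auto.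
Qed.

Lemma sel_minus {A : Type} r : forall s (l : list A) v, length s = length r ->
  In v (sel r l) -> In v (sel s l) \/ In v (sel (minus r s) l).
Proof.
  induction r as [|a r IH]; intros [|b s] [|u l] v Ls H; simpl in *; try discriminate; try tauto.
  injection Ls as Ls. destruct a; simpl in H.
  - destruct H as [->|H].
    + destruct b; simpl; tauto.
    + destruct (IH s l v Ls H); destruct b; simpl; tauto.
  - destruct (IH s l v Ls H); destruct b; simpl; tauto.
Qed.

Lemma ones_minus_fill r : forall y, ones (minus r (fill r y)) + ones (fill r y) = ones r.
Proof.
  unfold ones. induction r as [|[] r IH]; intros y; simpl; auto.
  destruct (hd false y); simpl; rewrite <- (IH (tl y)); lia.
Qed.

Lemma map_nth_seq {A B : Type} (g : A -> B) (l : list A) (a : A) :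
  map (fun i => g (nth i l a)) (seq 0 (length l)) = map g l.
Proof.
  induction l as [|b l IH]; simpl; auto. f_equal.
  rewrite <- seq_shift, map_map. exact IH.
Qed.

Lemma decode_set_sel n m : length m = n -> decode_set n m = sel m (seq 0 n).
Proof.
  intros <-. unfold decode_set.
  assert (E : forall s, filter (fun i => nth (i - s) m false) (seq s (length m)) =
                        sel m (seq s (length m))).
  { induction m as [|b m IH]; intros s; auto. cbn [length seq filter sel].
    rewrite Nat.sub_diag. change (nth 0 (b :: m) false) with b.
    replace (filter (fun i => nth (i - s) (b :: m) false) (seq (S s) (length m)))
      with (sel m (seq (S s) (length m))); [destruct b; reflexivity|].
    rewrite <- IH. apply filter_ext_in. intros i Hi. apply in_seq in Hi.
    replace (i - s) with (S (i - S s)) by lia. reflexivity. }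
  rewrite <- E. apply filter_ext. intros i. now rewrite Nat.sub_0_r.
Qed.

(** * Adjacency matrices and induced subgraphs *)

Definition rows (G : graph) : list (list bool) :=
  map (fun i => map (gadj G i) (seq 0 (gn G))) (seq 0 (gn G)).

Lemma enc_rows G : enc G = concat (rows G).
Proof. apply flat_map_concat_map. Qed.

Lemma square_rows G : square (gn G) (rows G).
Proof.
  split; [unfold rows; now rewrite length_map, length_seq|].
  apply Forall_forall. intros row H. apply in_map_iff in H as (i & <- & _).
  now rewrite length_map, length_seq.
Qed.

Lemma enc_length G : length (enc G) = gn G * gn G.
Proof. rewrite enc_rows. apply concat_square, square_rows. Qed.

Definition verts (G : graph) (m : list bool) : list nat := sel m (seq 0 (gn G)).

Lemma verts_ones G m : length m = gn G -> length (verts G m) = ones m.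
Proof. intros L; apply sel_ones. now rewrite length_seq. Qed.

Lemma verts_vset G m : vset G (verts G m).
Proof.
  split; [apply sel_NoDup, seq_NoDup|].
  intros v H. apply sel_incl, in_seq in H. lia.
Qed.

Lemma submatrix_rows G m :
  submatrix m (rows G) =
  concat (map (fun u => map (gadj G u) (verts G m)) (verts G m)).
Proof.
  unfold submatrix, rows, verts. rewrite sel_map, map_map. f_equal.
  apply map_ext; intros u. apply sel_map.
Qed.

Lemma submatrix_zero G m :
  existsb (fun b => b) (submatrix m (rows G)) = true <->
  exists u v, In u (verts G m) /\ In v (verts G m) /\ gadj G u v = true.
Proof.
  rewrite submatrix_rows, existsb_exists. split.
  - intros (b & Hb & E). apply in_concat in Hb as (row & Hr & Hb).
    apply in_map_iff in Hr as (u & <- & Hu). apply in_map_iff in Hb as (v & E' & Hv).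
    exists u, v; repeat split; auto; congruence.
  - intros (u & v & Hu & Hv & E). exists true; split; auto.
    apply in_concat. exists (map (gadj G u) (verts G m)). split.
    + apply in_map_iff; eauto.
    + rewrite <- E. now apply in_map.
Qed.

(** Vertices are renumbered by their position in [l], because a [graph] lives on an initial segment;
    answers of the given machine refer to these positions. *)
Definition induced (G : graph) (l : list nat) : graph :=
  {| gn := length l;
     gadj := fun i j => gadj G (nth i l 0) (nth j l 0);
     gadj_sym := fun i j => gadj_sym G _ _;
     gadj_irrefl := fun i => gadj_irrefl G _ |}.

(** Together with [submatrix_rows] this identifies the bits produced by [extract] with the encoding
    of the induced subgraph, the input on which the given machine is simulated. *)
Lemma enc_induced G l :
  enc (induced G l) = concat (map (fun u => map (gadj G u) l) l).
Proof.
  unfold enc; simpl. rewrite flat_map_concat_map. f_equal.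
  rewrite <- (map_nth_seq (fun u => map (gadj G u) l) l 0). apply map_ext. intros i.
  apply (map_nth_seq (gadj G (nth i l 0))).
Qed.

(** Heredity, by composing embeddings, is what permits calling the given algorithm again on the
    remaining vertices. *)
Lemma H_free_induced H G l : vset G l -> H_free H G -> H_free H (induced G l).
Proof.
  intros [N B] F (f & F1 & F2 & F3). apply F. exists (fun i => nth (f i) l 0).
  split; [|split].
  - intros i Hi. apply B, nth_In, F1, Hi.
  - intros i j Hi Hj E. apply F2; auto.
    apply (proj1 (NoDup_nth l 0) N); auto; apply F1; auto.
  - intros i j Hi Hj. apply F3; auto.
Qed.

Lemma verts_fill G r y : length r = gn G -> length y = ones r ->
  verts G (fill r y) = map (fun i => nth i (verts G r) 0) (decode_set (ones r) y).
Proof.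
  intros Lr Ly. rewrite decode_set_sel by auto. unfold verts at 1.
  rewrite sel_fill by (rewrite ?length_seq; auto). fold (verts G r).
  rewrite <- sel_map. f_equal.
  rewrite <- (verts_ones G r Lr).
  rewrite (map_nth_seq (fun v => v) (verts G r) 0). now rewrite map_id.
Qed.

(** * Independent sets and cliques *)

Lemma independent_incl G I J : independent G I -> incl J I -> NoDup J -> independent G J.
Proof.
  intros [[_ B] E] S N. split; [split; auto|intros u v Hu Hv; apply E; auto].
Qed.

Lemma alpha_attained G : exists I, independent G I /\ alpha G = length I.
Proof.
  unfold alpha.
  assert (SL : forall l I, In I (sublists l) -> incl I l /\ (NoDup l -> NoDup I)).
  { induction l as [|a l IH]; simpl; intros I H.
    - destruct H as [<-|[]]. split; auto; apply incl_refl.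
    - apply in_app_iff in H as [H|H].
      + apply in_map_iff in H as (J & <- & HJ). apply IH in HJ as [H1 H2]. split.
        * intros v [->|Hv]; [now left|right; auto].
        * intros N; inversion N; subst; constructor; auto.
      + apply IH in H as [H1 H2]. split; [now apply incl_tl|].
        intros N; inversion N; auto. }
  assert (AI : forall I, In I (filter (indepb G) (sublists (seq 0 (gn G)))) -> independent G I).
  { intros I H. apply filter_In in H as [H1 H2]. apply SL in H1 as [H1 H3]. split; [split|].
    - apply H3, seq_NoDup.
    - intros v Hv. apply H1, in_seq in Hv. lia.
    - intros u v Hu Hv. unfold indepb in H2. rewrite forallb_forall in H2.
      specialize (H2 u Hu). rewrite forallb_forall in H2. specialize (H2 v Hv).
      now apply negb_true_iff. }
  induction (filter _ _) as [|J L IH]; simpl.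
  (* The fold starts from 0, a value attained by the empty set. *)
  - exists []. split; auto. split; [split|]; [constructor|intros v []|intros u v []].
  - destruct (Nat.max_dec (length J) (fold_right Nat.max 0 (map (@length nat) L))) as [E|E];
      rewrite E.
    + exists J; split; auto. apply AI; now left.
    + apply IH. intros I H. apply AI; now right.
Qed.

(* A clique meets an independent set in at most one vertex. *)
Lemma independent_minus_clique G I r s : length s = length r ->
  independent G I -> incl I (verts G r) -> clique G (verts G s) ->
  exists J, independent G J /\ incl J (verts G (minus r s)) /\ length I <= S (length J).
Proof.
  intros Ls HI Hr [_ HC].
  set (inS := fun v => existsb (Nat.eqb v) (verts G s)).
  assert (InS : forall v, inS v = true <-> In v (verts G s)).
  { intros v; unfold inS. rewrite existsb_exists. split.
    - intros (u & Hu & E). apply Nat.eqb_eq in E; congruence.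
    - intros H; exists v; split; auto. apply Nat.eqb_refl. }
  exists (filter (fun v => negb (inS v)) I). split; [|split].
  - eapply independent_incl; [exact HI|apply incl_filter|apply NoDup_filter, HI].
  - intros v Hv. apply filter_In in Hv as [Hv E].
    destruct (sel_minus r s _ v Ls (Hr v Hv)) as [H|H]; auto.
    apply InS in H. rewrite H in E; discriminate.
  - rewrite <- (filter_length inS I).
    assert (length (filter inS I) <= 1); [|lia].
    assert (N : NoDup (filter inS I)) by apply NoDup_filter, HI.
    assert (P : forall v, In v (filter inS I) -> In v I /\ In v (verts G s)).
    { intros v Hv. apply filter_In in Hv as [H1 H2]. split; auto. now apply InS. }
    destruct (filter inS I) as [|u [|v J]]; simpl; try lia.
    assert (Hu := P u (or_introl eq_refl)). assert (Hv := P v (or_intror (or_introl eq_refl))).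
    assert (u <> v) by (intros ->; inversion N; subst; simpl in *; tauto).
    destruct HI as [_ HI]. specialize (HI u v (proj1 Hu) (proj1 Hv)).
    specialize (HC u v (proj2 Hu) (proj2 Hv) H). congruence.
Qed.

Lemma independent_length_le G I r : length r = gn G -> independent G I ->
  incl I (verts G r) -> length I <= ones r.
Proof.
  intros Lr [[N _] _] S. rewrite <- (verts_ones G r Lr). now apply NoDup_incl_length.
Qed.

(* The vertex set computed from an answer y of the given algorithm on G[r]. *)
Lemma homogeneous_fill G r y (S := verts G (fill r y)) :
  length r = gn G -> length y = ones r ->
  clique (induced G (verts G r)) (decode_set (ones r) y) \/
  independent (induced G (verts G r)) (decode_set (ones r) y) ->
  length (decode_set (ones r) y) = ones (fill r y) /\
  if existsb (fun b => b) (submatrix (fill r y) (rows G))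
  then clique G S /\ 2 <= ones (fill r y) else independent G S.
Proof.
  intros Lr Ly HD. assert (Lf : length (fill r y) = gn G) by now rewrite fill_length.
  assert (ES : S = map (fun i => nth i (verts G r) 0) (decode_set (ones r) y))
    by now apply verts_fill.
  split; [now rewrite <- (verts_ones G _ Lf), verts_fill, length_map|].
  destruct (existsb _ _) eqn:E.
  (* The edge found provides two distinct vertices and rules out that the returned set is
     independent, so that it is a clique. *)
  - apply submatrix_zero in E as (u & v & Hu & Hv & E). fold S in Hu, Hv.
    assert (u <> v) by (intros ->; rewrite gadj_irrefl in E; discriminate).
    split.
    + split; [apply verts_vset|]. rewrite ES in *.
      destruct HD as [[_ HD]|[_ HD]].
      * intros u' v' Hu' Hv' N. apply in_map_iff in Hu' as (i & <- & Hi).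
        apply in_map_iff in Hv' as (j & <- & Hj). apply (HD i j); auto. congruence.
      * apply in_map_iff in Hu as (i & <- & Hi). apply in_map_iff in Hv as (j & <- & Hj).
        specialize (HD i j Hi Hj). simpl in HD. congruence.
    + rewrite <- (verts_ones G _ Lf). fold S.
      change 2 with (length [u; v]). apply NoDup_incl_length.
      * constructor; [simpl; intros [->|[]]; auto|constructor; [intros []|constructor]].
      * intros w [<-|[<-|[]]]; auto.
  - split; [apply verts_vset|]. intros u v Hu Hv.
    destruct (gadj G u v) eqn:Ea; auto. rewrite <- E. symmetry.
    apply submatrix_zero. eauto.
Qed.

(** * The main loop *)

Lemma reset_length m : length (reset m) = length m.
Proof. unfold reset. destruct (_ =? _); auto. now destruct m. Qed.

Lemma ones_reset m : m <> [] -> ones (reset m) = Nat.max 1 (ones m).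
Proof.
  intros N. unfold reset. destruct (Nat.eqb_spec (ones m) 0) as [E|E]; [|lia].
  rewrite E. destruct m as [|[] m]; [congruence| |]; unfold ones in *; simpl in *; lia.
Qed.

Definition finds_homogeneous (H : graph) (d : R) (M : TM) (c : nat) : Prop :=
  forall G, H_free H G ->
    exists y, runs_within M (enc G) (c * (length (enc G) + 2) ^ c) y /\
      length y = gn G /\
      (clique G (decode_set (gn G) y) \/ independent G (decode_set (gn G) y)) /\
      (INR (length (decode_set (gn G) y)) >= npow (gn G) d)%R.

Definition body_cost (M : TM) (c n : nat) : nat :=
  29 * n * n + 33 * n + 60 + c * (n * n + 2) ^ c * (2 * tm_states M + 17) + tm_states M.

(** The mask [r] may be empty here, with [npow] giving 0 in that case; this covers the empty
    graph. *)
Lemma body_step H d M c G r : tm_valid M -> finds_homogeneous H d M c ->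
  H_free H G -> length r = gn G ->
  exists s, length s = gn G /\ (INR (ones s) >= npow (ones r) d)%R /\
    ones (minus r s) + ones s = ones r /\
    sexec (body M)
      (St [] (concat (rows G)) r [] [] [] [] [] [] [] [] []) (body_cost M c (gn G))
      (if existsb (fun b => b) (submatrix s (rows G))
       then St [] (concat (rows G)) (reset (minus r s)) [] [] [] [] [] [] [] [] [true]
       else St (rev s) (concat (rows G)) r [] [] [] [] [] [] [] [] []) /\
    if existsb (fun b => b) (submatrix s (rows G))
    then clique G (verts G s) /\ 2 <= ones s else independent G (verts G s).
Proof.
  intros V A F Lr. pose proof (verts_ones G r Lr) as Lv.
  destruct (A (induced G (verts G r))) as (y & Rw & Ly & HD & Sz);
    [apply H_free_induced; [apply verts_vset|exact F]|].
  simpl gn in *. rewrite Lv in *.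
  destruct (homogeneous_fill G r y Lr Ly HD) as [Ls Hs]. rewrite Ls in Sz.
  exists (fill r y). repeat split; auto.
  - now rewrite fill_length.
  - apply ones_minus_fill.
  - rewrite enc_induced, <- submatrix_rows in Rw.
    rewrite <- (app_nil_r (rev _)), <- rev_append_rev.
    eapply sexec_le; [apply (s_body M (gn G)); eauto; apply square_rows|].
    pose proof (submatrix_length (gn G) r (rows G) (square_rows G)) as Lx.
    unfold body_cost.
    assert (c * (length (submatrix r (rows G)) + 2) ^ c <= c * (gn G * gn G + 2) ^ c)
      by (apply Nat.mul_le_mono_l, Nat.pow_le_mono_l; lia).
    apply (Nat.mul_le_mono_r _ _ (2 * tm_states M + 17)) in H0. lia.
Qed.

(** The induction on [k] is strong, as a round deletes a whole clique. The output is that of the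
    last round, so the inductive bound has the same [s], and only the independent set and [k]
    change. *)
Lemma body_loop H d M c G : (0 < d)%R -> (d <= 1 / 2)%R ->
  tm_valid M -> finds_homogeneous H d M c -> H_free H G ->
  forall k r, ones r = k -> 1 <= k -> length r = gn G ->
  exists s, length s = gn G /\ independent G (verts G s) /\ 1 <= ones s /\
    (forall I, independent G I -> incl I (verts G r) -> good d (length I) (ones s) k) /\
    exists fin, get 0 fin = rev s /\
      sexec (poploop kF TSkip (body M))
        (St [] (concat (rows G)) r [] [] [] [] [] [] [] [] [true])
        (k * (body_cost M c (gn G) + 1) + 1) fin.
Proof.
  intros Hd Hd2 V A F k. induction k as [k IH] using lt_wf_ind. intros r Hr Hk Lr.
  destruct (body_step H d M c G r V A F Lr) as (s & Ls & Sz & Om & E & Hs).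
  rewrite Hr in *. assert (Np : npow k d = Rpower (INR k) d) by (destruct k; [lia|reflexivity]).
  rewrite Np in Sz. apply Rge_le in Sz.
  destruct (existsb _ _).
  - destruct Hs as [Cl O2]. assert (Lm : length (minus r s) = gn G)
      by (rewrite minus_length; congruence).
    assert (Nm : minus r s <> []).
    { intros Em. rewrite Em in Lm. pose proof (ones_le r). simpl in Lm. lia. }
    destruct (IH (ones (reset (minus r s)))) with (r := reset (minus r s))
      as (s' & Ls' & Is' & Os' & Gs' & fin & Ef & E'); auto.
    + rewrite ones_reset by auto. lia.
    + rewrite ones_reset by auto. lia.
    + now rewrite reset_length.
    + exists s'. repeat (split; [assumption|]). split.
      * intros I HI Ir.
        destruct (independent_minus_clique G I r s) as (J & HJ & Jr & LJ); auto; [congruence|].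
        pose proof (independent_length_le G J _ Lm HJ Jr) as LJ'.
        (* If nothing remains, the clique was all of R and [I] has at most one vertex; the reset set
           is then not related to [I], but it ensures a nonempty output. *)
        destruct (Nat.eq_dec (ones (minus r s)) 0) as [Z|Z].
        -- apply good_le with 1; [apply good_one; auto|lia].
        -- apply good_le with (S (length J)); [|exact LJ].
           apply good_step with (c := ones s); auto; [lia|].
           replace (k - ones s) with (ones (reset (minus r s)))
             by (rewrite ones_reset; auto; lia).
           apply Gs'; auto. unfold reset. now rewrite (proj2 (Nat.eqb_neq _ _) Z).
      * exists fin; split; [exact Ef|].
        eapply s_loop_cons; [unfold nstacks; lia|reflexivity|exact E|exact E'|].
        (* Even with the reset the count decreases: a clique of at least two vertices means
           [k >= 2], and [max 1 (k - c) <= k - 1]. Hence [k] rounds suffice. *)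
        assert (Lt : ones (reset (minus r s)) <= k - 1) by (rewrite ones_reset; auto; lia).
        apply (Nat.mul_le_mono_r _ _ (body_cost M c (gn G) + 1)) in Lt.
        rewrite Nat.mul_sub_distr_r in Lt. nia.
  - assert (1 <= ones s).
    { apply INR_lt. simpl INR. apply Rlt_le_trans with (2 := Sz). apply Rpower_pos. }
    exists s. repeat (split; [assumption|]). split.
    + intros I HI Ir. apply good_base; auto.
      rewrite <- Hr. eapply independent_length_le; eauto.
    + eexists; split; [|eapply s_loop_cons;
        [unfold nstacks; lia|reflexivity|exact E|loop_nil|]]; [reflexivity|].
      nia.
Qed.

(** * Polynomial running time *)

Definition poly_bounded (f : nat -> nat) : Prop :=
  exists c, forall z, f z <= c * (z + 2) ^ c.

Lemma poly_mono a b c z : a <= c -> b <= c -> a * (z + 2) ^ b <= c * (z + 2) ^ c.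
Proof. intros; apply Nat.mul_le_mono; auto. apply Nat.pow_le_mono_r; lia. Qed.

Lemma poly_const a : poly_bounded (fun _ => a).
Proof.
  exists a; intros z. pose proof (Nat.pow_nonzero (z + 2) a). nia.
Qed.

Lemma poly_id : poly_bounded (fun z => z).
Proof. exists 1; intros z; simpl; lia. Qed.

Lemma poly_add f g : poly_bounded f -> poly_bounded g -> poly_bounded (fun z => f z + g z).
Proof.
  intros [a F] [b G]. exists (a + b); intros z. specialize (F z). specialize (G z).
  assert (P : forall e, e <= a + b -> (z + 2) ^ e <= (z + 2) ^ (a + b))
    by (intros; apply Nat.pow_le_mono_r; lia).
  pose proof (Nat.mul_le_mono_l _ _ a (P a ltac:(lia))).
  pose proof (Nat.mul_le_mono_l _ _ b (P b ltac:(lia))). lia.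
Qed.

Lemma poly_mul f g : poly_bounded f -> poly_bounded g -> poly_bounded (fun z => f z * g z).
Proof.
  (* The constant must dominate both the product [a * b] of the factors and the sum [a + b] of the
     exponents. *)
  intros [a F] [b G]. exists (a * b + a + b); intros z.
  etransitivity; [apply Nat.mul_le_mono; [apply F|apply G]|].
  replace (a * (z + 2) ^ a * (b * (z + 2) ^ b)) with (a * b * (z + 2) ^ (a + b))
    by (rewrite Nat.pow_add_r; ring).
  apply poly_mono; lia.
Qed.

Lemma poly_pow c : poly_bounded (fun z => (z + 2) ^ c).
Proof. exists (S c); intros z. rewrite <- (Nat.mul_1_l ((z + 2) ^ c)). apply poly_mono; lia. Qed.

(** The cost in terms of the input length [z = n^2]. Since [n <= n^2], the terms [29 * n^2 + 33 * n]
    of a round become [62 * z], and [12 * n^2 + 8 * n] for the input becomes [20 * z]. *)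
Definition input_cost (M : TM) (c z : nat) : nat :=
  let b := 62 * z + 60 + c * (z + 2) ^ c * (2 * tm_states M + 17) + tm_states M in
  let n := 20 * z + 2 + ((z + 1) * (b + 1) + 1) in
  100 * n * (z + n) + 2.

Lemma input_cost_poly M c : poly_bounded (input_cost M c).
Proof.
  unfold input_cost.
  repeat match goal with
  | |- poly_bounded (fun z => ?a + ?b) => apply (poly_add (fun z => a) (fun z => b))
  | |- poly_bounded (fun z => ?a * ?b) => apply (poly_mul (fun z => a) (fun z => b))
  | |- poly_bounded (fun z => ?a) => first [apply poly_id|apply poly_pow|apply (poly_const a)]
  end.
Qed.

Lemma program_correct H d M c G : (0 < d)%R -> (d <= 1 / 2)%R ->
  tm_valid M -> finds_homogeneous H d M c -> H_free H G ->
  exists s, length s = gn G /\ independent G (verts G s) /\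
    (1 <= gn G -> forall I, independent G I -> good d (length I) (ones s) (gn G)) /\
    runs_within (from_stacks (program M)) (enc G) (input_cost M c (length (enc G))) s.
Proof.
  intros Hd Hd2 V A F. set (n := gn G).
  assert (O1 : ones (repeat true n) = n) by (unfold ones; now rewrite count_occ_repeat_eq).
  assert (Le : length (repeat true n) = n) by apply repeat_length.
  cut (exists s, length s = n /\ independent G (verts G s) /\
    (1 <= n -> forall I, independent G I -> good d (length I) (ones s) n) /\
    exists fin, get 0 fin = rev s /\
      sexec (poploop kF TSkip (body M))
        (St [] (concat (rows G)) (repeat true n) [] [] [] [] [] [] [] [] [true])
        ((n + 1) * (body_cost M c n + 1) + 1) fin).
  { intros (s & Ls & Is & Gs & fin & Ef & E). exists s. repeat (split; [assumption|]).
    apply (s_program M n (rows G)) in E; [|apply square_rows]. rewrite <- enc_rows in E.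
    destruct (from_stacks_correct _ _ _ _ _ E Ef) as (k & Hk & R).
    exists k; split; [|exact R]. etransitivity; [exact Hk|].
    rewrite enc_length. fold n. unfold input_cost, body_cost.
    assert (Nz : n <= n * n) by nia.
    set (b := 62 * (n * n) + 60 + _ + _).
    set (b' := 29 * n * n + _ + _ + _ + _).
    assert (Lb : b' <= b) by (unfold b, b'; lia).
    assert (L1 : (n + 1) * (b' + 1) <= (n * n + 1) * (b + 1)) by (apply Nat.mul_le_mono; lia).
    apply Nat.add_le_mono_r, Nat.mul_le_mono; lia. }
  (* [body_loop] starts from a nonempty mask. On the empty graph there is one round, for which the
     factor [n + 1] leaves room. *)
  destruct (Nat.eq_dec n 0) as [Z|Z].
  - destruct (body_step H d M c G (repeat true n) V A F Le) as (s & Ls & _ & _ & E & Hs).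
    fold n in Ls, E. rewrite Z in *. destruct s; [|discriminate]. simpl existsb in *.
    exists []. repeat (split; [easy|]). eexists; split;
      [|eapply s_loop_cons; [unfold nstacks; lia|reflexivity|exact E|loop_nil|lia]]. reflexivity.
  - destruct (body_loop H d M c G Hd Hd2 V A F n (repeat true n)) as (s & Ls & Is & _ & Gs & fin & Ef & E);
      auto; [lia|].
    exists s. repeat (split; [assumption|]). split.
    + intros _ I HI. apply Gs; auto.
      assert (EV : verts G (repeat true n) = seq 0 n).
      { unfold verts. fold n. clear. generalize 0. induction n; intros a; simpl; f_equal; auto. }
      rewrite EV. intros v Hv. apply in_seq. destruct HI as [[_ B] _].
      specialize (B v Hv). fold n in B. lia.
    + exists fin; split; [exact Ef|]. eapply sexec_le; [exact E|fold n; lia].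
Qed.

Open Scope R_scope.

Theorem theorem6 (H : graph) (delta : R) :
  0 < delta -> delta <= 1 / 2 ->
  polytime_graph_algorithm (H_free H)
    (fun G S => (clique G S \/ independent G S) /\
                INR (length S) >= npow (gn G) delta) ->
  forall eps : R, 0 < eps ->
    polytime_graph_algorithm (H_free H)
      (fun G S => independent G S /\
         INR (length S) >= INR (alpha G) /
                           npow (gn G) (1 - (delta - delta ^ 2 - eps))).
Proof.
  intros Hd Hd2 (M & c & V & A) eps Heps.
  destruct (input_cost_poly M c) as [c' Hc'].
  exists (from_stacks (program M)), c'. split; [apply machine_valid|].
  intros G F. destruct (program_correct H delta M c G Hd Hd2 V A F) as (s & Ls & Is & Gs & k & Hk & R).
  exists s. split; [exists k; split; [|exact R]|split; [exact Ls|]].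
  - etransitivity; [exact Hk|apply Hc'].
  - rewrite decode_set_sel by exact Ls. fold (verts G s). split; [exact Is|].
    rewrite verts_ones by exact Ls. destruct (alpha_attained G) as (I & HI & ->).
    destruct (gn G) as [|n] eqn:En.
    (* On the empty graph the divisor is [npow 0 _ = 0], but the numerator is 0 as well, and so is
       the quotient. *)
    + replace (length I) with 0%nat.
      * unfold Rdiv. rewrite Rmult_0_l. apply Rle_ge, pos_INR.
      * destruct HI as [[_ B] _]. destruct I as [|v I]; auto.
        specialize (B v (or_introl eq_refl)). lia.
    + destruct (Gs ltac:(lia) I HI) as [_ B]. unfold npow.
      assert (N1 : 1 <= INR (S n)) by (apply (le_INR 1); lia).
      (* The claimed exponent exceeds [1 - delta + delta^2] by [eps], and the base is at least 1. *)
      assert (P : Rpower (INR (S n)) (1 - delta + delta ^ 2) <=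
                  Rpower (INR (S n)) (1 - (delta - delta ^ 2 - eps)))
        by (apply Rle_Rpower; lra).
      apply (Rmult_le_compat_l (INR (ones s))) in P; [|apply pos_INR].
      apply Rle_ge. apply Rmult_le_reg_r with (1 := Rpower_pos (INR (S n)) (1 - (delta - delta ^ 2 - eps))).
      unfold Rdiv. rewrite Rmult_assoc, Rinv_l, Rmult_1_r by (apply Rgt_not_eq, Rpower_pos). lra.
Qed.
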